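(* Let $p>q$ be distinct odd primes with $p\equiv 1 \pmod q$. Let $N$ be a group of order $pq$ and let $L/K$ be a separable field extension of degree $pq$ admitting a Hopf–Galois structure of type $N$. Then every parallel extension $L'/K$ to $L/K$ also admits a Hopf–Galois structure of type $N$.
   Context: Let $L/K$ be a finite separable field extension of degree $n$ with Galois closure $E/K$, and put $G=\mathrm{Gal}(E/K)$, $G'=\mathrm{Gal}(E/L)$. Hopf–Galois structures on $L/K$ correspond bijectively (Greither–Pareigis) to subgroups $R\le \mathrm{Perm}(G/G')$ that are regular on the coset space $G/G'$ and normalised by $\lambda(G)$, where $\lambda(g)(hG')=ghG'$; the type of the structure is the isomorphism class of the group $R$. Equivalently (Byott), for a group $N$ of order $n$, $L/K$ admits a Hopf–Galois structure of type $N$ if and only if there is a subgroup $M\le \mathrm{Hol}(N)$ transitive on $N$ and an isomorphism $\phi:G\to M$ with $\phi(G')=\mathrm{Stab}_M(1_N)$. Here $\mathrm{Hol}(N)=N\rtimes\mathrm{Aut}(N)$, with elements $[\eta,\alpha]$, multiplication $[\eta,\alpha][\mu,\beta]=[\eta\alpha(\mu),\alpha\beta]$, and action on $N$ by $[\eta,\alpha]\cdot\mu=\eta\alpha(\mu)$. A parallel extension to $L/K$ is a subextension $L'/K$ of $E/K$ with $[L':K]=[L:K]$. *)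

(* Defs.v *)
From HB Require Import structures.
From mathcomp Require Import all_boot all_order all_fingroup all_algebra all_solvable all_field.

Set Implicit Arguments.
Unset Strict Implicit.
Unset Printing Implicit Defensive.

Import GRing.Theory GroupScope.

(* The base field K is the subspace 1 of the K-algebra Omega, and the
   extensions of K considered are subfields of Omega; [L : K] is \dim L. *)

Definition is_galois_closure (K : fieldType) (Omega : splittingFieldType K)
    (L E : {subfield Omega}) : Prop :=
  [/\ galois 1%AS E, (L <= E)%VS
    & forall F : {subfield Omega}, galois 1%AS F -> (L <= F)%VS -> (E <= F)%VS].

(* In 'Gal(E / K), g * h means "first g, then h" (galM), the opposite of
   composition.  So the coset h G' for composition is G' :* h here, the coset
   space G / G' is rcosets G' G, and left translation h G' |-> (g o h) G' is
   right translation by g.  The group Perm(G / G') is perm.Sym (rcosets G' G), the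
   permutations of {set gT} which fix everything outside G / G'. *)

Definition coset_translation (gT : finGroupType) (G G' : {group gT}) (g : gT) :
    {perm {set gT}} :=
  restr_perm (rcosets G' G) (actperm 'Rs%act g).

Definition regular_on (T : finType) (X : {set T}) (R : {group {perm T}}) : Prop :=
  [/\ R \subset perm.Sym X, [transitive R, on X | 'P]
    & forall x, x \in X -> 'C_R[x | 'P] = 1].

(* A Hopf-Galois structure on L / K is given, following Greither and Pareigis,
   by a regular subgroup R of Perm(G / G') normalised by lambda(G); its type
   is the isomorphism class of R.  Here E is the Galois closure of L itself,
   which can be smaller than Omega. *)
Definition admits_Hopf_Galois_structure (K : fieldType)
    (Omega : splittingFieldType K) (L : {subfield Omega})
    (gT : finGroupType) (N : {group gT}) : Prop :=
  exists2 E : {subfield Omega}, is_galois_closure L E &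
    let G := 'Gal(E / 1%AS)%G in
    let G' := 'Gal(E / L)%G in
    exists R : {group {perm {set gal_of E}}},
      [/\ regular_on (rcosets G' G) R,
          [set coset_translation G G' g | g in G] \subset 'N(R)
        & R \isog N].

Definition parallel_extension (K : fieldType) (E : splittingFieldType K)
    (L L' : {subfield E}) : Prop :=
  \dim L' = \dim L.

(* Main.v *)
Require Import Defs.
From mathcomp Require Import all_boot all_order all_fingroup all_algebra all_solvable all_field.

Set Implicit Arguments.
Unset Strict Implicit.
Unset Printing Implicit Defensive.

(** Write G, H and H' for the Galois groups of E over K, L and L'.  A regular
    subgroup of Perm (G / H) isomorphic to N and normalised by the translations
    identifies G / H with N in such a way that G acts on N through Hol(N).
    Recording where g sends 1 gives a crossed homomorphism f : G -> N, for an
    action a of G on N by automorphisms, with kernel H.  Conversely, when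
    #|G : H| = #|N|, such an f is onto and turns translations of N into a
    regular normalised subgroup ([cocycle_type_of_regular],
    [regular_of_cocycle_type]).  This criterion makes sense for actions that are
    not faithful, so it can be tested in G although the Galois closure of L' may
    be smaller than E ([cocycle_type_galois_closure]).  Since E is the Galois
    closure of L, the subgroup H has trivial core, and the theorem becomes
    [cocycle_type_parallel]: in a group G with such a cocycle for H, every
    subgroup H' of index p q is the kernel of a cocycle onto N as well.

    Write N = P ><| Q with #|P| = p and #|Q| = q, and let W be the Sylow
    p-subgroup of G, which turns out to be normal.  Suppose first that W meets
    H' in a normal subgroup of G.  Then H' is the intersection of a subgroup A
    of index p, obtained from Hall's theorem, and of W H', of index q.  As
    solvable groups act affinely on prime numbers of points, there are cocycles
    onto P with kernel A and onto Q with kernel W H'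
    ([cocycle_type_prime_index]); they can be glued into a cocycle onto N
    ([cocycle_type_combine]).  If N is abelian this settles everything, because
    then W has order p and meets H' trivially.

    If N is not abelian, W embeds in P x P and contains the commutator subgroup
    of G ([cocycle_pcore]).  The case left is that W has order p ^ 2 and that
    both H' and H meet it in a subgroup of order p that is not normal in G.  In
    this case W = T1 x T2 for two normal subgroups of G, acting on N as right
    and as left translations, and H' and H meet W in lines transversal to T1 and
    T2.  Preserving such a line forces an element of G to act on W as a power
    map, which determines the rest of H' and of H up to conjugacy
    ([transversal_normal_form]).  An automorphism of G that is a power map on T2
    and the identity on a complement of T2 then carries H' to H, up to conjugacy,
    and transports the cocycle ([cocycle_type_nonabelian]). *)

Import GroupScope.

(** * Crossed homomorphisms onto a group of the same order as the coset space *)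

(** An element g of G acts on N by n |-> a g n * f g, an element of Hol(N);
    f g is the image of 1 and a g the automorphism part. *)
Definition cocycle (gT nT : finGroupType) (G : {group gT}) (N : {group nT})
    (f : gT -> nT) (a : gT -> nT -> nT) : Prop :=
  [/\ {in G, forall x, f x \in N},
      {in G, forall g, {in N, forall n, a g n \in N}},
      {in G, forall g, {in N &, {morph a g : m n / m * n}}}
    & {in G &, forall x g, f (x * g) = a g (f x) * f g}].

(** As #|G : H| = #|N|, the kernel condition makes f onto: this is
    Byott's description, a transitive action of G on N through Hol(N) in which
    H is the stabiliser of 1, for an action that may fail to be faithful. *)
Definition cocycle_type (gT nT : finGroupType) (G H : {group gT})
    (N : {group nT}) : Prop :=
  exists f a, [/\ cocycle G N f a, H \subset G,
    {in G, forall x, (f x == 1) = (x \in H)} & #|G : H| = #|N|].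

Lemma morph_on1 (nT rT : finGroupType) (N : {group nT}) (b : nT -> rT) :
  {in N &, {morph b : m n / m * n}} -> b 1 = 1.
Proof.
move=> bM; apply: (mulgI (b 1)); rewrite mulg1 -bM ?group1 // mulg1.
by [].
Qed.

Lemma morph_onX (nT rT : finGroupType) (N : {group nT}) (b : nT -> rT) :
    {in N &, {morph b : m n / m * n}} ->
  {in N, forall n k, b (n ^+ k) = b n ^+ k}.
Proof.
move=> bM n Nn; elim=> [|k IHk]; first exact: morph_on1 bM.
by rewrite !expgS bM ?groupX // IHk.
Qed.

(** The maps [a g] are constrained on M only; replacing them by permutations
    with support in M makes kernels and images of the action available. *)
Lemma Aut_actm (gT nT : finGroupType) (G : {group gT}) (M : {group nT})
    (a : gT -> nT -> nT) :
    {in G, forall g, {in M, forall n, a g n \in M}} ->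
    {in G, forall g, {in M &, {morph a g : m n / m * n}}} ->
    {in G, forall g, {in M &, injective (a g)}} ->
    {in G &, forall g h, {in M, forall n, a (g * h) n = a h (a g n)}} ->
  exists A : {morphism G >-> {perm nT}},
    A @* G \subset Aut M /\ {in G, forall g, {in M, A g =1 a g}}.
Proof.
move=> aN aM aI aJ.
pose A g : {perm nT} :=
  odflt 1 [pick s in Aut M | [forall n in M, s n == a g n]].
have AP g : g \in G -> A g \in Aut M /\ {in M, A g =1 a g}.
  move=> Gg; rewrite /A; case: pickP => [s /andP[AutS /forall_inP sE] | noA] /=.
    by split=> // n Nn; apply/eqP/sE.
  have stabg : a g @: M \subset M.
    by apply/subsetP=> _ /imsetP[n Nn ->]; apply: aN.
  have /negP[] := noA (perm_in (aI g Gg) stabg); apply/andP; split; last first.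
    by apply/forall_inP=> n Nn; rewrite perm_inE.
  rewrite inE perm_in_on; apply/morphicP=> m n Nm Nn.
  by rewrite !perm_inE ?groupM // aM.
have AM : {in G &, {morph A : g h / g * h}}.
  move=> g h Gg Gh.
  have [[AAg Eg] [AAh Eh]] := (AP g Gg, AP h Gh).
  have [AAgh Egh] := AP _ (groupM Gg Gh).
  apply: (eq_Aut AAgh) => [|n Nn]; first exact: groupM.
  by rewrite permM Egh // Eg // Eh ?aN // aJ.
exists (Morphism AM); split=> [|g Gg]; last by case: (AP g Gg).
by apply/subsetP=> _ /morphimP[g _ Gg ->]; case: (AP g Gg).
Qed.

Section CocycleTheory.

Variables (gT nT : finGroupType) (G H : {group gT}) (N : {group nT}).
Variables (f : gT -> nT) (a : gT -> nT -> nT).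
Hypothesis fa : cocycle G N f a.
Hypothesis sHG : H \subset G.
Hypothesis kerf : {in G, forall x, (f x == 1) = (x \in H)}.
Hypothesis iHG : #|G : H| = #|N|.

Let fN : {in G, forall x, f x \in N}. Proof. by case: fa. Qed.
Let aN : {in G, forall g, {in N, forall n, a g n \in N}}.
Proof. by case: fa. Qed.
Let aM : {in G, forall g, {in N &, {morph a g : m n / m * n}}}.
Proof. by case: fa. Qed.
Let fM : {in G &, forall x g, f (x * g) = a g (f x) * f g}.
Proof. by case: fa. Qed.

Lemma cocycle1 : f 1 = 1.
Proof. by apply/eqP; rewrite kerf. Qed.

Lemma cocycle_actM_im : {in G & &, forall g h x,
  a (g * h) (f x) = a h (a g (f x))}.
Proof.
move=> g h x Gg Gh Gx; apply: (mulIg (f (g * h))).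
rewrite -fM ?groupM // mulgA fM ?groupM // fM // aM ?aN ?fN //.
by rewrite -mulgA -fM.
Qed.

Lemma cocycle_act1_im : {in G, forall x, a 1 (f x) = f x}.
Proof. by move=> x Gx; rewrite -{2}[x]mulg1 fM // cocycle1 mulg1. Qed.

(** Since f x = a y (f (x * y^-1)) * f y, the claim is that [a y] sends no
    other value of f to 1, and [a y^-1] undoes [a y] on the values of f. *)
Lemma cocycle_eq : {in G &, forall x y, (f x == f y) = (x * y^-1 \in H)}.
Proof.
move=> x y Gx Gy; have Gz : x * y^-1 \in G by rewrite groupM ?groupV.
have -> : f x = a y (f (x * y^-1)) * f y by rewrite -fM // mulgKV.
rewrite -kerf // -{2}[f y]mul1g (inj_eq (mulIg _)).
apply/eqP/eqP => [a1 | ->]; last first.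
  exact: morph_on1 (aM Gy).
rewrite -[LHS]cocycle_act1_im // -(mulgV y) cocycle_actM_im ?groupV // a1.
by rewrite (morph_on1 (aM _)) ?groupV.
Qed.

(** A count: f is injective on the right cosets of H. *)
Lemma cocycle_onto : {in N, forall n, exists2 x, x \in G & f x = n}.
Proof.
suff: f @: G = N.
  by move=> <- n /imsetP[x Gx ->]; exists x.
apply/eqP; rewrite eqEcard; apply/andP; split.
  by apply/subsetP=> _ /imsetP[x Gx ->]; apply: fN.
rewrite -iHG /indexg -[X in _ <= X](card_imset _ (@set1_inj _)).
(* the fibres of f are the right cosets of H *)
pose r (C : {set gT}) := [set f (repr C)].
rewrite -(@card_in_imset _ _ r); last first.
  move=> _ _ /rcosetsP[x Gx ->] /rcosetsP[y Gy ->] /set1_inj.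
  have Gr z : z \in G -> repr (H :* z) \in G.
    have /rcosetP[h Hh ->] := mem_repr_rcoset H z.
    by move=> Gz; rewrite groupM // (subsetP sHG).
  move/eqP; rewrite cocycle_eq ?Gr // -mem_rcoset => /rcoset_eqP E.
  by rewrite -(rcoset_repr H x) -(rcoset_repr H y).
apply: subset_leq_card; apply/subsetP=> _ /imsetP[_ /rcosetsP[x Gx ->] ->].
apply: imset_f; apply: imset_f.
have /rcosetP[h Hh ->] := mem_repr_rcoset H x.
by rewrite groupM // (subsetP sHG).
Qed.

Lemma cocycle_actM : {in G &, forall g h, {in N, forall n,
  a (g * h) n = a h (a g n)}}.
Proof.
move=> g h Gg Gh n /cocycle_onto[x Gx <-]; exact: cocycle_actM_im.
Qed.

Lemma cocycle_act1 : {in N, forall n, a 1 n = n}.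
Proof. by move=> n /cocycle_onto[x Gx <-]; apply: cocycle_act1_im. Qed.

Lemma cocycle_actK : {in G, forall g, {in N, cancel (a g) (a g^-1)}}.
Proof.
move=> g Gg n Nn.
by rewrite -cocycle_actM ?groupV // mulgV cocycle_act1.
Qed.

Lemma cocycle_act_inj : {in G, forall g, {in N &, injective (a g)}}.
Proof. by move=> g Gg; apply: can_in_inj (cocycle_actK Gg). Qed.

(** Inversion in N exchanges right and left translations.  Whatever is proved
    for the elements of G acting on N as right translations, those with [a g]
    trivial, therefore also holds for those acting as left translations. *)
Lemma cocycle_flip :
  cocycle G N (fun x => (f x)^-1) (fun g n => a g n ^ f g).
Proof.
split=> [x Gx | g Gg n Nn | g Gg m n Nm Nn | x g Gx Gg].
- by rewrite groupV fN.
- by rewrite groupJ ?aN ?fN.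
- by rewrite aM // conjMg.
have <- : (a g (f x))^-1 = a g (f x)^-1.
  by apply/eqP; rewrite eq_invg_mul -aM ?groupV ?fN // mulgV
     (morph_on1 (aM Gg)).
by rewrite fM // invMg conjgE -!mulgA mulgV mulg1.
Qed.

Lemma cocycle_actm : exists A : {morphism G >-> {perm nT}},
  A @* G \subset Aut N /\ {in G, forall g, {in N, A g =1 a g}}.
Proof.
apply: Aut_actm => // [g Gg|]; last exact: cocycle_actM.
exact: cocycle_act_inj _ Gg.
Qed.

(** An element with trivial automorphism part is a right translation of N, and
    Hol(N) normalises the group of right translations. *)
Lemma cocycle_conj x g : x \in G -> g \in G -> {in N, forall n, a x n = n} ->
  {in N, forall n, a (x ^ g) n = n} /\ f (x ^ g) = a g (f x) ^ f g.
Proof.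
move=> Gx Gg ax1.
have axg n : n \in N -> a (x ^ g) n = n.
  have actM := cocycle_actM.
  have GVg : g^-1 \in G by rewrite groupV.
  move=> Nn; have Nn' := aN GVg Nn.
  rewrite conjgE (actM _ _ GVg (groupM Gx Gg) _ Nn) (actM _ _ Gx Gg _ Nn').
  by rewrite ax1 // -actM // mulVg cocycle_act1.
split=> //; apply: (mulgI (f g)); rewrite (conjgE (a g _)) mulKVg -fM //.
by rewrite (conjgC x) (fM Gg (groupJ Gx Gg)) axg ?fN.
Qed.

(** The elements x as in the hypotheses form the kernel of the map from G to
    Hol(N), which is a normal subgroup of G contained in H. *)
Lemma cocycle_faithful x : gcore H G = 1 -> x \in G -> f x = 1 ->
  {in N, forall n, a x n = n} -> x = 1.
Proof.
move=> core1 Gx fx1 ax1; apply/set1P; rewrite -[[set 1]]core1.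
apply/bigcapP=> g; rewrite -groupV => Gg.
rewrite mem_conjg -kerf ?groupJ //; have [_ ->] := cocycle_conj Gx Gg ax1.
by rewrite fx1 (morph_on1 (aM Gg)) conj1g.
Qed.

End CocycleTheory.

(** * Changing the group, the kernel and the target *)

(** The image of r may be small; the condition on #|G1 : H1| is what
    makes the composite with r onto. *)
Lemma cocycle_type_pullback (gT hT nT : finGroupType) (D G1 H1 : {group gT})
    (G2 H2 : {group hT}) (N : {group nT}) (r : {morphism D >-> hT}) :
    G1 \subset D -> r @* G1 \subset G2 -> H1 \subset G1 ->
    {in G1, forall x, (r x \in H2) = (x \in H1)} -> #|G1 : H1| = #|N| ->
  cocycle_type G2 H2 N -> cocycle_type G1 H1 N.
Proof.
move=> sG1D sr sHG1 rH iHG1 [f [a [[fN aN aM fM] _ kerf _]]].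
have rG x : x \in G1 -> r x \in G2.
  by move=> G1x; apply: (subsetP sr); apply: mem_morphim; rewrite ?(subsetP sG1D).
exists (f \o r), (fun g => a (r g)); split=> //; last first.
  by move=> x G1x /=; rewrite kerf ?rG ?rH.
split=> [x G1x | g G1g n Nn | g G1g m n Nm Nn | x g G1x G1g] /=.
- by rewrite fN ?rG.
- by rewrite aN ?rG.
- by rewrite aM ?rG.
by rewrite morphM ?(subsetP sG1D) // fM ?rG.
Qed.

(** As H1 contains the kernel of r, the value of f at an element of G1
    depends on its image under r only.  This moves a cocycle from the Galois
    group of a large extension to that of a Galois closure inside it. *)
Lemma cocycle_type_pushforward (gT hT nT : finGroupType) (G1 H1 : {group gT})
    (G2 H2 : {group hT}) (N : {group nT}) (r : {morphism G1 >-> hT}) :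
    r @* G1 = G2 -> r @* H1 = H2 -> 'ker r \subset H1 ->
  cocycle_type G1 H1 N -> cocycle_type G2 H2 N.
Proof.
move=> rG1 rH1 skH1 [f [a [fa sHG1 kerf iHG1]]].
have [fN aN aM fM] := fa.
pose s y := odflt 1 [pick x in G1 | r x == y].
have sP y : y \in G2 -> s y \in G1 /\ r (s y) = y.
  rewrite -rG1 => /morphimP[x _ Gx ->]; rewrite /s.
  by case: pickP => [z /andP[Gz /eqP rz] | /(_ x)]; rewrite ?Gx ?eqxx.
have fr x y : x \in G1 -> y \in G1 -> r x = r y -> f x = f y.
  move=> Gx Gy rxy; apply/eqP; rewrite (cocycle_eq fa kerf) //.
  apply: (subsetP skH1); rewrite !inE groupM ?groupV //=.
  by rewrite morphM ?morphV ?groupV // rxy mulgV.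
exists (f \o s), (fun g => a (s g)); split.
- split=> [x /sP[]| g /sP[Gg _] n Nn | g /sP[Gg _] m n Nm Nn | x g] /=.
  + by move=> Gx _; apply: fN.
  + exact: aN.
  + exact: aM.
  move=> G2x G2g; have [[Gx rx] [Gg rg]] := (sP x G2x, sP g G2g).
  have [Gxg rxg] := sP _ (groupM G2x G2g).
  by rewrite -fM //; apply: fr; rewrite ?groupM // rxg morphM // rx rg.
- by rewrite -rG1 -rH1 morphimS.
- move=> y /sP[Gx /= {2}<-]; rewrite kerf // -rH1.
  apply/idP/morphimP => [Hx | [x _ Hx rxy]]; first by exists (s y).
  have Gx' := subsetP sHG1 x Hx.
  by rewrite -kerf // (fr _ _ Gx Gx' rxy) kerf.
rewrite -iHG1 -(index_morphim_ker r sHG1 (subxx _)) rG1 rH1.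
suff /eqP->: #|'ker_G1 r : H1| == 1%N by rewrite muln1.
by rewrite indexg_eq1 subIset // skH1 orbT.
Qed.

Lemma cocycle_type_isog (gT nT mT : finGroupType) (G H : {group gT})
    (N : {group nT}) (M : {group mT}) :
  N \isog M -> cocycle_type G H N -> cocycle_type G H M.
Proof.
case/isogP=> h injh hN [f [a [[fN aN aM fM] sHG kerf iHG]]].
have hM n : n \in N -> h n \in M.
  by move=> Nn; rewrite -hN mem_morphim.
have kN m : m \in M -> invm injh m \in N.
  by rewrite -hN => /morphimP[n _ Nn ->]; rewrite invmE.
have hK m : m \in M -> h (invm injh m) = m.
  by rewrite -hN => Mm; rewrite invmK.
exists (h \o f), (fun g m => h (a g (invm injh m))); split=> //.
- split=> [x Gx | g Gg n Mn | g Gg m n Mm Mn | x g Gx Gg] /=.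
  + by rewrite hM ?fN.
  + by rewrite hM ?aN ?kN.
  + rewrite morphM /= ?hN // aM ?kN //.
    by rewrite [RHS]/= -morphM ?aN ?kN.
  by rewrite invmE ?fN // fM // morphM ?aN ?fN.
- by move=> x Gx /=; rewrite morph_injm_eq1 ?fN ?kerf.
by rewrite iHG -hN card_injm.
Qed.

(** A conjugate of H is the stabiliser of another point. *)
Lemma cocycle_type_conj (gT nT : finGroupType) (G H : {group gT})
    (N : {group nT}) w :
  w \in G -> H \subset G -> cocycle_type G (H :^ w) N -> cocycle_type G H N.
Proof.
move=> Gw sHG tHw; have [_ [_ [_ _ _ iHw]]] := tHw.
apply: (cocycle_type_pullback (r := conjgm_morphism G w) (subxx G) _ sHG) tHw.
- by rewrite morphim_conj setIid conjGid.
- by move=> x Gx; rewrite /= memJ_conjg.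
by rewrite -iHw -{2}(conjGid Gw) indexJg.
Qed.

(** The cocycle is the projection to M along B, for the action of G on M
    by conjugation by the component in B. *)
Lemma cocycle_type_sdprod (gT : finGroupType) (M B G : {group gT}) :
  M ><| B = G -> cocycle_type G B M.
Proof.
move=> defG; have [_ mulMB nMB tiMB] := sdprodP defG.
have tiBM : B :&: M = 1 by rewrite setIC.
have defG' : B * M = G by rewrite -mulMB -normC.
have sMG : M \subset G by rewrite -mulMB mulG_subl.
have sBG : B \subset G by rewrite -mulMB mulG_subr.
pose f := remgr B M; pose b := divgr B M.
have fM x : x \in G -> f x \in M by rewrite -defG'; apply: mem_remgr.
have bB x : x \in G -> b x \in B by rewrite -defG'; apply: mem_divgr.
have bN x m : x \in G -> m \in M -> m ^ b x \in M.
  by move=> Gx Mm; rewrite memJ_norm // (subsetP nMB) ?bB.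
exists f, (fun g m => m ^ b g); split=> //.
- split=> [x Gx | g Gg n Nn | g Gg m n _ _ | x g Gx Gg]; rewrite ?fM ?bN //.
    by rewrite conjMg.
  have /= -> : x * g = (b x * b g) * (f x ^ b g * f g).
    rewrite {1}[x](divgr_eq B M) {1}[g](divgr_eq B M) -/(b x) -/(b g).
    have E (u v s t : gT) : u * v * (s * t) = (u * s) * (v ^ s * t).
      by rewrite conjgE -!mulgA mulKVg.
    exact: E.
  have Bxg := groupM (bB x Gx) (bB g Gg).
  exact: remgrMid tiBM _ _ Bxg (groupM (bN _ _ Gg (fM x Gx)) (fM g Gg)).
- move=> x Gx; apply/eqP/idP => [f1 | Bx]; last exact: remgr1.
  by rewrite (divgr_eq B M x) -/(f x) f1 mulg1; apply: bB.
by rewrite -divgS // -(sdprod_card defG) mulnK.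
Qed.

(** * Solvable groups acting on a prime number of points *)

(** Galois: a solvable transitive group of prime degree is affine.  Modulo
    the core of B, a minimal normal subgroup M of G is abelian and not contained
    in B, hence transitive as B is maximal; M meets B in a subgroup normalised
    by B and M, so in the trivial group, and B is a complement of M. *)
Lemma cocycle_type_prime_index (gT nT : finGroupType) (G B : {group gT})
    (Q : {group nT}) :
    solvable G -> B \subset G -> prime #|Q| -> #|G : B| = #|Q| ->
  cocycle_type G B Q.
Proof.
move=> solG sBG prQ iBG; pose K := [group of gcore B G].
have nsKG : K <| G := gcore_normal sBG.
have [sKG nKG] := andP nsKG.
have sKB : K \subset B := gcore_sub B G.
have sBGb : B / K \subset G / K by apply: quotientS.
have iBGb : #|G / K : B / K| = #|Q|.
  by rewrite index_quotient_eq // subIset // sKB orbT.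
have core1 (M : {group coset_of K}) :
    M \subset B / K -> M <| G / K -> M :=: 1.
  move=> sMB nsMG; have [L defM sKL nsLG] := inv_quotientN nsKG nsMG.
  have sLB : L \subset B.
    by rewrite -(quotientSGK _ sKB) -?defM ?(subset_trans (normal_sub nsLG)).
  by apply/trivgP; rewrite defM quotient_sub1 ?sub_gcore //
    ?(subset_trans (normal_sub nsLG)) // normal_norm.
have ntG : G / K != 1.
  by apply: contraTneq prQ => G1; rewrite -iBGb G1 -indexgI
    (setIidPl (sub1G _)) indexgg.
have [M minM sMG] := minnormal_exists ntG (normG _).
have [nMG ntM abM] := minnormal_solvable minM sMG (quotient_sol K solG).
have cMM := abelem_abelian abM.
have nsMG : M <| G / K by apply/andP.
have nMB : B / K \subset 'N(M) := subset_trans sBGb nMG.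
(* B / K is maximal, its index being prime *)
have mulMB : M * (B / K) = G / K.
  have sMBG : M <*> (B / K) \subset G / K by rewrite join_subG sMG.
  have := Lagrange_index sMBG (joing_subr M (B / K)).
  rewrite iBGb /= norm_joinEr // => iMB.
  have: #|M * (B / K) : B / K| %| #|Q| by rewrite -iMB dvdn_mull.
  case/primeP: prQ => Q1 prQ /prQ/pred2P[] iMB'.
    have sMB : M \subset B / K.
      rewrite -norm_joinEr // in iMB'; move/eqP: iMB'; rewrite indexg_eq1.
      by rewrite join_subG => /andP[].
    by rewrite (core1 _ sMB nsMG) eqxx in ntM.
  rewrite -norm_joinEr //; apply: index1g => //; rewrite /= norm_joinEr //.
  move/eqP: iMB; rewrite iMB' -{2}[#|Q|]mul1n eqn_pmul2r ?(ltnW Q1) //.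
  by move/eqP.
have tiMB : M :&: (B / K) = 1.
  apply: core1; first exact: subsetIr.
  rewrite /normal (subset_trans (subsetIl _ _)) //= -{1}mulMB mul_subG //.
    exact: sub_abelian_norm cMM (subsetIl _ _).
  by rewrite normsI ?normG.
have defG : M ><| (B / K) = G / K by rewrite sdprodE.
have oM : #|M| = #|Q|.
  by apply/eqP; rewrite -iBGb -divgS // -(sdprod_card defG) mulnK.
have isoMQ : M \isog Q.
  by rewrite isog_cyclic_card ?prime_cyclic ?oM // eqxx.
have typeB := cocycle_type_isog isoMQ (cocycle_type_sdprod defG).
apply: (cocycle_type_pullback (r := coset_morphism K) nKG _ sBG _ iBG typeB).
  by [].
move=> x Gx; apply/idP/idP => [/morphimP[y Ny By /= exy] | Bx].
  have /rcosetP[k Kk ->] : x \in K :* y.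
    by rewrite -val_coset // -exy val_coset ?rcoset_refl // (subsetP nKG).
  by rewrite groupM // (subsetP sKB).
by apply: mem_quotient.
Qed.

(** * Gluing a cocycle to P and a cocycle to Q *)

Lemma cyclic_endo_expg (gT : finGroupType) (P : {group gT}) (b : gT -> gT) :
    cyclic P -> {in P, forall x, b x \in P} ->
    {in P &, {morph b : x y / x * y}} ->
  exists k, {in P, forall x, b x = x ^+ k}.
Proof.
case/cyclicP=> z defP bP bM; have Pz : z \in P by rewrite defP cycle_id.
have := bP z Pz; rewrite {1}defP => /cycleP[k bz]; exists k => x.
rewrite defP => /cycleP[i ->].
by rewrite (morph_onX bM) // bz -!expgM mulnC.
Qed.

(** The new cocycle is fQ * fP.  In the product formula for it, the
    component in P has to be moved past fQ h, which is compensated by the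
    automorphism x |-> aP h x ^ (fQ h)^-1 of P.  Together with [aQ h] on Q this
    defines an endomorphism of N provided that [aQ h] does not change the action
    of Q on P, hence the two alternatives on N and aQ. *)
Lemma cocycle_type_combine (gT nT : finGroupType) (G A B H : {group gT})
    (N P Q : {group nT}) (fQ : gT -> nT) (aQ : gT -> nT -> nT) :
    P ><| Q = N -> cyclic P -> abelian Q ->
    cocycle G Q fQ aQ -> {in G, forall x, (fQ x == 1) = (x \in B)} ->
    abelian N \/ {in G, forall g, {in Q, forall s, aQ g s = s}} ->
    cocycle_type G A P -> H \subset G -> A :&: B = H -> #|G : H| = #|N| ->
  cocycle_type G H N.
Proof.
move=> defN cycP abQ [fQN aQN aQM fQM] kerQ abNQ [fP [aP [fa sAG kerP iAG]]].
move=> sHG defH iHG; have [fPN aPN aPM fPM] := fa.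
have [_ mulPQ nPQ tiPQ] := sdprodP defN.
have tiQP : Q :&: P = 1 by rewrite setIC.
have defN' : Q * P = N by rewrite -mulPQ -normC.
have sPN : P \subset N by rewrite -mulPQ mulG_subl.
have sQN : Q \subset N by rewrite -mulPQ mulG_subr.
have nJ s x : s \in Q -> x \in P -> x ^ s \in P.
  by move=> Qs Px; rewrite memJ_norm // (subsetP nPQ).
pose a g n := aQ g (divgr Q P n) * aP g (remgr Q P n) ^ (fQ g)^-1.
have aE g s x : s \in Q -> x \in P -> a g (s * x) = aQ g s * aP g x ^ (fQ g)^-1.
  by move=> Qs Px; rewrite /a divgrMid // remgrMid.
have NP n : n \in N -> exists s x, [/\ s \in Q, x \in P & n = s * x].
  by rewrite -defN' => /mulsgP[s x Qs Px ->]; exists s, x.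
have key g t x : g \in G -> t \in Q -> x \in P ->
    aP g (x ^ t) ^ (fQ g)^-1 = (aP g x ^ (fQ g)^-1) ^ aQ g t.
  move=> Gg Qt Px.
  have Pax : aP g x \in P by apply: aPN.
  have [abN | aQ1] := abNQ.
    have cN u v : u \in P -> v \in Q -> u ^ v = u.
      move=> Pu Qv; apply/conjg_fixP/commgP.
      exact: (centsP abN) _ (subsetP sPN _ Pu) _ (subsetP sQN _ Qv).
    by rewrite !cN ?groupV ?fQN ?aQN ?cN // groupV fQN.
  rewrite aQ1 // -conjgM.
  have [k tk] : exists k, {in P, forall y, y ^ t = y ^+ k}.
    apply: cyclic_endo_expg cycP _ _ => [y Py | y z _ _]; first exact: nJ.
    exact: conjMg.
  have -> : (fQ g)^-1 * t = t * (fQ g)^-1.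
    by apply: (centsP abQ); rewrite ?groupV ?fQN.
  by rewrite conjgM !tk ?aPN // (morph_onX (aPM g Gg)).
exists (fun g => fQ g * fP g), a; split=> //.
- split=> [x Gx | g Gg n /NP[s [x [Qs Px ->]]] | g Gg m n | x g Gx Gg].
  + by rewrite -defN' mem_mulg ?fQN ?fPN.
  + by rewrite aE // -defN' mem_mulg ?aQN ?nJ ?groupV ?fQN ?aPN.
  + move=> /NP[s [x [Qs Px ->]]] /NP[t [y [Qt Py ->]]].
    have -> : s * x * (t * y) = s * t * (x ^ t * y).
      by rewrite conjgE -!mulgA mulKVg.
    have Pxt := nJ _ _ Qt Px.
    rewrite !aE // ?(groupM Qs Qt) ?(groupM Pxt Py) // aQM // aPM //.
    rewrite conjMg key //.
    by rewrite (conjgE _ (aQ g t)) -!mulgA mulKVg.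
  rewrite fQM // fPM // aE ?fQN ?fPN // (conjgE (aP g _)) invgK.
  by rewrite !mulgA mulgKV.
move=> x Gx; rewrite -defH inE -kerP // -kerQ //.
apply/eqP/andP => [e | [/eqP-> /eqP->]]; last by rewrite mulg1.
have PQ : fQ x \in Q :&: P.
  by rewrite inE fQN //= -groupV; move/eqP: e; rewrite -eq_invg_mul => /eqP->;
   rewrite fPN.
by move: PQ e; rewrite tiQP => /set1P->; rewrite mul1g => ->.
Qed.

(** * Subgroups meeting a normal Sylow subgroup in a normal subgroup *)

Lemma setI_coprime_index (gT : finGroupType) (G A B H : {group gT}) m n :
    A \subset G -> B \subset G -> H \subset A :&: B -> #|G : A| = m ->
    #|G : B| = n -> coprime m n -> #|G : H| = (m * n)%N ->
  A :&: B = H.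
Proof.
move=> sAG sBG sHAB iA iB co_mn iH.
have sIG : A :&: B \subset G by rewrite subIset ?sAG.
have iI : (m * n)%N %| #|G : A :&: B|.
  by rewrite Gauss_dvd // -{1}iA -{1}iB !indexgS ?subsetIl ?subsetIr.
have := Lagrange_index sIG sHAB; rewrite iH => iIH.
apply/esym/index1g=> //; apply/eqP; rewrite -dvdn1.
rewrite -(@dvdn_pmul2l #|G : A :&: B|) ?indexg_gt0 // muln1.
by rewrite /= iIH.
Qed.

(** A is the product of T :&: H with a Hall p'-subgroup of G that contains
    a Hall p'-subgroup of H. *)
Lemma complement_index (gT : finGroupType) (p : nat) (G T H : {group gT}) :
    solvable G -> T <| G -> p.-Sylow(G) T -> H \subset G ->
    T :&: H <| G ->
  exists A : {group gT}, [/\ A \subset G, H \subset A & #|G : A| = #|T : H|].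
Proof.
move=> solG nsTG sylT sHG nsSG.
have sylS := setI_normal_Hall nsTG sylT sHG.
have [C hallC] := Hall_exists p^' (solvableS sHG solG).
have [sCH p'C _] := and3P hallC.
have [D hallD sCD] := Hall_superset solG (subset_trans sCH sHG) p'C.
have sDG := pHall_sub hallD.
have nSD : D \subset 'N(T :&: H) := subset_trans sDG (normal_norm nsSG).
have defG := sdprod_normal_p'HallP nsTG hallD sylT.
have nsSH : T :&: H <| H by apply: normalS (subsetIr _ _) sHG nsSG.
have /sdprodP[_ defH _ _] := sdprod_normal_p'HallP nsSH hallC sylS.
exists ((T :&: H) <*> D)%G; split=> /=.
- by rewrite join_subG (normal_sub nsSG).
- by rewrite -{1}defH norm_joinEr ?mulgS.
have tiSD : (T :&: H) :&: D = 1.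
  by have [_ _ _ tiTD] := sdprodP defG; apply/trivgP; rewrite -tiTD
    setSI ?subsetIl.
have sSDG : (T :&: H) <*> D \subset G by rewrite join_subG (normal_sub nsSG).
apply/eqP; rewrite -(eqn_pmul2l (cardG_gt0 ((T :&: H) <*> D))) Lagrange //.
rewrite /= norm_joinEr // TI_cardMg // mulnAC LagrangeI.
by rewrite (sdprod_card defG).
Qed.

Lemma hom_cocycle (gT nT : finGroupType) (G B : {group gT}) (Q : {group nT}) :
    B <| G -> G / B \isog Q ->
  exists2 f, cocycle G Q f (fun _ s => s)
           & {in G, forall x, (f x == 1) = (x \in B)}.
Proof.
move=> nsBG /isogP[h injh hQ]; have nBG := normal_norm nsBG.
exists (fun x => h (coset B x)) => [|x Gx].
  split=> [x Gx | g Gg n | g Gg m n | x g Gx Gg] //=.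
    by rewrite -hQ mem_morphim ?mem_quotient.
  by rewrite !morphM ?mem_quotient // (subsetP nBG).
rewrite morph_injm_eq1 ?mem_quotient //.
apply/eqP/idP=> [|/coset_id//]; exact/coset_idr/(subsetP nBG).
Qed.

Lemma index_normal_Sylow (gT : finGroupType) (p q : nat) (G T H : {group gT}) :
    prime p -> coprime p q -> T <| G -> p.-Sylow(G) T -> H \subset G ->
    #|G : H| = (p * q)%N -> #|T : H| = p.
Proof.
move=> pr_p co_pq nsTG sylT sHG iH.
have sylS := setI_normal_Hall nsTG sylT sHG.
apply/eqP; rewrite -(eqn_pmul2l (cardG_gt0 (T :&: H))) LagrangeI.
rewrite (card_Hall sylT) (card_Hall sylS) -(Lagrange sHG) iH.
have q0 : 0 < q.
  case: q iH {co_pq} => //; rewrite muln0 => /eqP.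
  by rewrite eqn0Ngt indexg_gt0.
have p0 := prime_gt0 pr_p.
rewrite !partnM ?muln_gt0 ?cardG_gt0 ?p0 // (part_pnat_id (pnat_id pr_p)).
have p'q : p^'.-nat q by rewrite p'natE // -prime_coprime.
by rewrite (part_p'nat p'q) muln1.
Qed.

(** H is the intersection of a subgroup A of index p, provided by
    [complement_index], and of T H, of index q.  If N is not abelian the gluing
    needs the cocycle with kernel T H to be a homomorphism, and T H is normal
    with cyclic quotient because it contains the commutator subgroup. *)
Lemma cocycle_type_of_Sylow (gT nT : finGroupType) (p q : nat)
    (G T H : {group gT}) (N P Q : {group nT}) :
    prime p -> prime q -> p != q -> solvable G -> T <| G -> p.-Sylow(G) T ->
    H \subset G -> #|G : H| = (p * q)%N -> T :&: H <| G ->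
    P ><| Q = N -> #|P| = p -> #|Q| = q ->
    abelian N \/ G^`(1) \subset T ->
  cocycle_type G H N.
Proof.
move=> pr_p pr_q neq_pq solG nsTG sylT sHG iH nsSG defN oP oQ abNT.
have co_pq : coprime p q by rewrite prime_coprime // dvdn_prime2.
have [A [sAG sHA iA]] := complement_index solG nsTG sylT sHG nsSG.
have iTH := index_normal_Sylow pr_p co_pq nsTG sylT sHG iH.
have nTH : H \subset 'N(T) := subset_trans sHG (normal_norm nsTG).
pose B := (T <*> H)%G.
have sBG : B \subset G by rewrite join_subG normal_sub.
have iB : #|G : B| = q.
  have := Lagrange_index sBG (joing_subr T H).
  rewrite iH /= norm_joinEr // -(normC nTH) indexMg iTH mulnC => /eqP.
  by rewrite eqn_pmul2l ?prime_gt0 // (normC nTH) -norm_joinEr // => /eqP.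
have defH : A :&: B = H.
  apply: (setI_coprime_index (m := p) (n := q)) iH => //.
    by rewrite subsetI sHA joing_subr.
  by rewrite iA.
have iHN : #|G : H| = #|N| by rewrite -(sdprod_card defN) oP oQ.
have typeA : cocycle_type G A P.
  by apply: cocycle_type_prime_index; rewrite ?oP // iA.
have cycP : cyclic P by rewrite prime_cyclic ?oP.
have abQ : abelian Q by rewrite cyclic_abelian // prime_cyclic ?oQ.
have [abN | sG'T] := abNT.
  have [fQ [aQ [fa _ kerQ _]]] : cocycle_type G B Q.
    by apply: cocycle_type_prime_index; rewrite ?oQ.
  exact: cocycle_type_combine defN cycP abQ fa kerQ (or_introl abN)
    typeA sHG defH iHN.
have nsBG : B <| G.
  by apply: sub_der1_normal => //; rewrite (subset_trans sG'T) ?joing_subl.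
have oGB : #|G / B| = q by rewrite card_quotient ?normal_norm.
have isoQ : G / B \isog Q.
  by rewrite isog_cyclic_card ?prime_cyclic ?oGB ?oQ /=.
have [fQ fa kerQ] := hom_cocycle nsBG isoQ.
by apply: cocycle_type_combine defN cycP abQ fa kerQ (or_intror _)
  typeA sHG defH iHN.
Qed.

(** * Abelian type *)

(** The elements that act on N as translations form a normal subgroup Z,
    which f embeds in N, and G / Z embeds in Aut N, which is abelian of order
    (p - 1)(q - 1), prime to p.  So G is solvable with a normal Sylow subgroup T
    of order p, and T :&: H' = 1. *)
Lemma cocycle_type_abelian (gT nT : finGroupType) (p q : nat)
    (G H H' : {group gT}) (N P Q : {group nT}) :
    prime p -> prime q -> q < p -> P ><| Q = N -> #|P| = p -> #|Q| = q ->
    abelian N -> cocycle_type G H N -> gcore H G = 1 ->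
    H' \subset G -> #|G : H'| = (p * q)%N ->
  cocycle_type G H' N.
Proof.
move=> pr_p pr_q lt_qp defN oP oQ abN [f [a [fa sHG kerf iHG]]] core1 sHG' iH'.
have neq_pq : p != q by rewrite gtn_eqF.
have co_pq : coprime p q by rewrite prime_coprime // dvdn_prime2.
have [fN aN aM fM] := fa.
have oN : #|N| = (p * q)%N by rewrite -(sdprod_card defN) oP oQ.
have [A [sAAut AE]] := cocycle_actm fa sHG kerf iHG.
have cycN : cyclic N.
  have [_ mulPQ _ _] := sdprodP defN.
  have [sPN sQN] : P \subset N /\ Q \subset N.
    by rewrite -mulPQ mulG_subl mulG_subr.
  rewrite -mulPQ; apply: cyclicM; rewrite ?prime_cyclic ?oP ?oQ //.
  exact: subset_trans sQN (subset_trans abN (centS sPN)).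
pose Z := ('ker A)%G.
have nsZG : Z <| G := ker_normal A.
have sZG := normal_sub nsZG.
have Z1 z : z \in Z -> {in N, forall n, a z n = n}.
  move=> Zz n Nn; have Gz := subsetP sZG z Zz.
  by rewrite -AE // (mker Zz) perm1.
have fZM : {in Z &, {morph f : x y / x * y}}.
  by move=> x y Zx Zy; rewrite fM ?(subsetP sZG) // Z1 // fN // (subsetP sZG).
have injfZ : 'injm (Morphism fZM).
  apply/subsetP=> z /morphpreP[Zz /set1P /= fz1]; apply/set1P.
  exact: (cocycle_faithful fa sHG kerf iHG core1 (subsetP sZG z Zz) fz1 (Z1 z Zz)).
have sfZN : Morphism fZM @* Z \subset N.
  by apply/subsetP=> _ /morphimP[z _ Zz ->]; rewrite fN // (subsetP sZG).
have abZ : abelian Z.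
  by rewrite -(injm_abelian injfZ) // (abelianS sfZN).
have oZ : #|Z| %| p * q by rewrite -(card_injm injfZ) // -oN cardSg.
have abGZ : abelian (G / Z).
  rewrite (isog_abelian (first_isog A)) (abelianS sAAut) //.
  exact: Aut_cyclic_abelian.
have p'GZ : p^'.-nat #|G : Z|.
  have : #|G : Z| %| totient (p * q).
    rewrite -oN -card_Aut_cyclic // -[#|G : Z|](_ : #|A @* G| = _) ?cardSg //.
    by rewrite card_morphim setIid.
  rewrite totient_coprime // !totient_prime // => /pnat_dvd; apply.
  rewrite pnatM !p'natE // !gtnNdvd //; first by case: (q) pr_q => [|[]].
  - by rewrite (leq_ltn_trans (leq_pred _)).
  - by case: (p) pr_p => [|[]].
  by rewrite prednK ?prime_gt0.
have solG : solvable G.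
  by rewrite (series_sol nsZG) !abelian_sol.
pose T := [group of 'O_p(Z)].
have nsTG : T <| G by apply: char_normal_trans nsZG; apply: pcore_char.
have sylTZ : p.-Sylow(Z) T := nilpotent_pcore_Hall p (abelian_nil abZ).
have sylT : p.-Sylow(G) T.
  rewrite pHallE normal_sub //= (card_Hall sylTZ) -(Lagrange sZG).
  by rewrite partnM ?cardG_gt0 // (part_p'nat p'GZ) muln1.
have iT := index_normal_Sylow pr_p co_pq nsTG sylT sHG' iH'.
have TH1 : T :&: H' = 1.
  have oT : #|T| %| p.
    rewrite (card_Hall sylTZ); apply: dvdn_trans (partn_dvd p _ oZ) _.
      by rewrite muln_gt0 !prime_gt0.
    rewrite partnM ?prime_gt0 // (part_pnat_id (pnat_id pr_p)).
    by rewrite part_p'nat ?muln1 // p'natE // -prime_coprime.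
  apply/card1_trivg/eqP; rewrite -dvdn1 -(@dvdn_pmul2r p) ?prime_gt0 //.
  by rewrite mul1n -{1}iT LagrangeI.
apply: (cocycle_type_of_Sylow pr_p pr_q neq_pq solG nsTG sylT sHG' iH' _
  defN oP oQ (or_introl abN)).
by rewrite TH1 normal1.
Qed.

(** * Nonabelian type: the normal Sylow subgroup and its invariant lines *)

Lemma card_dvd_ker_codomain (gT rT : finGroupType) (W : {group gT}) (b : gT -> rT)
    (bM : {in W &, {morph b : x y / x * y}}) (P : {group rT}) :
  {in W, forall x, b x \in P} -> #|W| %| #|'ker (Morphism bM)| * #|P|.
Proof.
move=> bP; rewrite -(Lagrange (subsetIl W _ : 'ker (Morphism bM) \subset W)).
rewrite dvdn_mul //= -[X in X %| _](_ : #|Morphism bM @* W| = _).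
  by apply: cardSg; apply/subsetP=> _ /morphimP[x _ Wx ->]; apply: bP.
by rewrite card_morphim setIid.
Qed.

Lemma generator_prime (gT : finGroupType) (T : {group gT}) x :
  prime #|T| -> x \in T -> x != 1 -> T :=: <[x]>.
Proof.
move=> pr_T Tx ntx; apply/eqP; rewrite eq_sym eqEcard cycle_subG Tx /=.
have: #[x] %| #|T| by apply: order_dvdG.
by case/primeP: pr_T => _ dvT /dvT; rewrite order_eq1 (negPf ntx) => /eqP <-.
Qed.

Section NonabelianNormalSylow.

Variables (nT : finGroupType) (p q : nat) (N P Q : {group nT}).
Hypotheses (pr_p : prime p) (pr_q : prime q) (lt_qp : q < p).
Hypotheses (defN : P ><| Q = N) (oP : #|P| = p) (oQ : #|Q| = q).
Hypothesis notabN : ~~ abelian N.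

Let sPN : P \subset N. Proof. by case/sdprod_context: defN => /andP[]. Qed.
Let nsPN : P <| N. Proof. by case/sdprod_context: defN. Qed.
Let neq_pq : p != q. Proof. by rewrite gtn_eqF. Qed.
Let sylP : p.-Sylow(N) P.
Proof.
rewrite pHallE sPN -(sdprod_card defN) oP oQ partnM ?prime_gt0 //.
have p'q : p^'.-nat q by rewrite p'natE // dvdn_prime2.
by rewrite (part_pnat_id (pnat_id pr_p)) (part_p'nat p'q) muln1 eqxx.
Qed.
Let cycP : cyclic P. Proof. by rewrite prime_cyclic ?oP. Qed.
Let abP : abelian P. Proof. exact: cyclic_abelian. Qed.
Let oNP : #|N : P| = q. Proof. by rewrite -(index_sdprod defN). Qed.

(** P is its own centraliser in N: as #|N : P| is prime, P would otherwise
    be central with N / P cyclic, and N would be abelian. *)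
Lemma cent1_prime_factor n x : n \in N -> x \in P -> x != 1 ->
  commute n x -> n \in P.
Proof.
move=> Nn Px ntx cnx.
have defP : P :=: <[x]> by apply: generator_prime; rewrite ?oP.
have Cn : n \in 'C_N(P) by rewrite inE Nn defP cent_cycle; apply/cent1P.
suff -> : P :=: 'C_N(P) by [].
have sPC : P \subset 'C_N(P) by rewrite subsetI sPN.
have := Lagrange_index (subsetIl N 'C(P)) sPC; rewrite oNP => iC.
have: #|'C_N(P) : P| %| q by rewrite -iC dvdn_mull.
case/primeP: (pr_q) => _ dvq /dvq/pred2P[] iC'.
  exact: index1g sPC iC'.
move: iC; rewrite iC' -{2}(mul1n q) => /eqP; rewrite eqn_pmul2r ?prime_gt0 //.
rewrite indexg_eq1 subsetI subxx /= => cPN; case/negP: notabN.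
apply: cyclic_center_factor_abelian; apply: (@dvdn_prime_cyclic _ _ q) => //.
have sPZ : P \subset 'Z(N) by rewrite subsetI sPN centsC.
by rewrite card_quotient ?normal_norm ?center_normal // -oNP indexgS.
Qed.

Section Endo.

Variable b : nT -> nT.
Hypothesis bN : {in N, forall n, b n \in N}.
Hypothesis bM : {in N &, {morph b : m n / m * n}}.
Hypothesis bI : {in N &, injective b}.

Lemma endo_Sylow x : x \in P -> b x \in P.
Proof.
move=> Px; have Nx := subsetP sPN x Px.
rewrite (mem_normal_Hall sylP) ?bN //; apply: (@pnat_dvd _ p) (pnat_id pr_p).
rewrite order_dvdn -(morph_onX bM) // -oP (expg_cardG Px).
by rewrite (morph_on1 bM).
Qed.

(** Conjugation by n and by [b n] induce on P two automorphisms that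
    correspond to each other under b.  Endomorphisms of a cyclic group commute,
    so the two coincide and n^-1 * b n centralises P. *)
Lemma endo_factor n : n \in N -> n^-1 * b n \in P.
Proof.
move=> Nn; have [x Px ntx] : exists2 x, x \in P & x != 1.
  by apply/trivgPn; rewrite trivg_card1 oP gtn_eqF ?prime_gt1.
have Nx := subsetP sPN x Px; have Pbx := endo_Sylow Px.
have ntbx : b x != 1.
  by apply: contraNneq ntx => bx1; apply/eqP/bI;
    rewrite ?group1 // bx1 (morph_on1 bM).
have [k nk] : exists k, {in P, forall y, y ^ n = y ^+ k}.
  apply: cyclic_endo_expg cycP _ _ => [y Py | y z _ _]; last exact: conjMg.
  by rewrite memJ_norm // (subsetP (normal_norm nsPN)).
have bJ : b x ^ b n = b x ^ n.
  rewrite [RHS]nk // -(morph_onX bM) // -nk //.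
  apply: (mulgI (b n)); rewrite -conjgC -!bM ?groupJ //.
  by rewrite -conjgC.
have ntbxn : b x ^ n != 1 by rewrite conjg_eq1.
have Nbn := bN Nn.
apply: (cent1_prime_factor _ _ ntbxn); first by rewrite groupM ?groupV.
  by rewrite memJ_norm // (subsetP (normal_norm nsPN)).
apply/commute_sym/commgP/conjg_fixP.
by rewrite -conjgM mulKVg bJ.
Qed.

End Endo.

Section Cocycle.

Variables (gT : finGroupType) (G H : {group gT}).
Variables (f : gT -> nT) (a : gT -> nT -> nT).
Hypothesis fa : cocycle G N f a.
Hypothesis sHG : H \subset G.
Hypothesis kerf : {in G, forall x, (f x == 1) = (x \in H)}.
Hypothesis iHG : #|G : H| = #|N|.
Hypothesis core1 : gcore H G = 1.

Let fN : {in G, forall x, f x \in N}. Proof. by case: fa. Qed.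
Let aN : {in G, forall g, {in N, forall n, a g n \in N}}.
Proof. by case: fa. Qed.
Let aM : {in G, forall g, {in N &, {morph a g : m n / m * n}}}.
Proof. by case: fa. Qed.
Let fM : {in G &, forall x g, f (x * g) = a g (f x) * f g}.
Proof. by case: fa. Qed.
Let aI : {in G, forall g, {in N &, injective (a g)}}.
Proof. exact: cocycle_act_inj fa sHG kerf iHG. Qed.
Let aJ : {in G &, forall g h, {in N, forall n, a (g * h) n = a h (a g n)}}.
Proof. exact: cocycle_actM fa sHG kerf iHG. Qed.
Let aP : {in G, forall g, {in P, forall x, a g x \in P}}.
Proof. by move=> g Gg x; apply: endo_Sylow (aN Gg) (aM Gg) _. Qed.
Let aNP : {in G, forall g, {in N, forall n, n^-1 * a g n \in P}}.
Proof. by move=> g Gg n; apply: endo_factor (aN Gg) (aM Gg) (aI Gg) _. Qed.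

(** Automorphisms of N act trivially on N / P by [endo_factor], so f
    composed with the projection to N / P is a homomorphism, of kernel G0. *)
Lemma cocycle_preim_normal : exists G0 : {group gT},
  [/\ G0 <| G, #|G : G0| = q, G^`(1) \subset G0
    & {in G, forall x, (x \in G0) = (f x \in P)}].
Proof.
have nPN := normal_norm nsPN.
have aC y n : y \in G -> n \in N -> coset P (a y n) = coset P n.
  move=> Gy Nn; have Pk := aNP Gy Nn; set k := n^-1 * _ in Pk.
  rewrite -[a y n](mulKVg n) -/k morphM /= ?(subsetP nPN n) //.
    by rewrite (coset_id Pk) mulg1.
  exact: (subsetP nPN) (subsetP sPN _ Pk).
have fbM : {in G &, {morph (fun x => coset P (f x)) : x y / x * y}}.
  move=> x y Gx Gy; rewrite /= fM // morphM ?(subsetP nPN) ?aN ?fN //.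
  by rewrite /= aC ?fN.
pose fb := Morphism fbM.
have kE x : x \in G -> (x \in 'ker fb) = (f x \in P).
  move=> Gx; rewrite !inE Gx /=; apply/eqP/idP => [|/coset_id//].
  by apply: coset_idr; rewrite (subsetP nPN) ?fN.
have im : fb @* G = N / P.
  apply/setP=> C; apply/morphimP/morphimP => [[x _ Gx ->] | [n _ Nn ->]].
    by exists (f x); rewrite ?(subsetP nPN) ?fN.
  by have [x Gx <-] := cocycle_onto fa sHG kerf iHG Nn; exists x.
exists ('ker fb)%G; split=> //=; first exact: ker_normal.
  rewrite -oNP -(card_quotient nPN) -im card_morphim.
  by rewrite setIid.
apply: der1_min; first exact: ker_norm.
have isoN : G / 'ker fb \isog N / P by rewrite -im first_isog.
rewrite (isog_abelian isoN).
by rewrite cyclic_abelian // prime_cyclic // (card_quotient nPN) oNP.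
Qed.

Let exQ : exists2 s, s \in N & N \subset P <*> <[s]>.
Proof.
have cycQ : cyclic Q by rewrite prime_cyclic ?oQ.
have [_ mulPQ nPQ _] := sdprodP defN; have [s defQ] := cyclicP cycQ.
have Qs : s \in Q by rewrite defQ cycle_id.
exists s; first by rewrite -mulPQ (subsetP (mulG_subr P Q)).
by rewrite -defQ -mulPQ norm_joinEr.
Qed.

(** An automorphism of N that is trivial on P is determined by the shift
    s^-1 * a x s of an element s generating N modulo P. *)
Lemma cocycle_shiftM (W : {group gT}) s : W \subset G -> s \in N ->
    {in W, forall x, {in P, forall n, a x n = n}} ->
  {in W &, {morph (fun x => s^-1 * a x s) : x y / x * y}}.
Proof.
move=> sWG Ns aW1 x y Wx Wy /=.
have [Gx Gy] := (subsetP sWG x Wx, subsetP sWG y Wy).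
have Pzx := aNP Gx Ns; have Pzy := aNP Gy Ns.
rewrite aJ // -{1}[a x s](mulKVg s) aM ?(subsetP sPN _ Pzx) //.
by rewrite (aW1 y Wy _ Pzx) mulgA; apply: (centsP abP).
Qed.

Lemma cocycle_act_triv x s : x \in G -> s \in N -> N \subset P <*> <[s]> ->
  {in P, forall n, a x n = n} -> a x s = s -> {in N, forall n, a x n = n}.
Proof.
move=> Gx Ns sN ax1 axs.
(* the fixed points of a x form a group containing P and s *)
have gF : group_set [set n in N | a x n == n].
  apply/group_setP; split=> [|m n].
    by rewrite inE group1 (morph_on1 (aM Gx)) eqxx.
  rewrite !inE => /andP[Nm /eqP am] /andP[Nn /eqP an].
  by rewrite groupM // aM // am an eqxx.
suff sNF : N \subset Group gF.
  by move=> n /(subsetP sNF); rewrite inE => /andP[_ /eqP].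
apply: subset_trans sN _; rewrite join_subG cycle_subG !inE Ns axs eqxx /= andbT.
apply/subsetP=> n Pn; by rewrite inE (subsetP sPN) // ax1 // eqxx.
Qed.

(** Let W consist of the x with f x in P and [a x] trivial on P.  Then G / W
    embeds in the product of N / P and Aut P, which is abelian of order prime to
    p, while f and the shift of [cocycle_shiftM] embed W in the product of two
    copies of P.  Hence W = 'O_p(G). *)
Lemma cocycle_pcore :
  [/\ p.-Sylow(G) 'O_p(G), G^`(1) \subset 'O_p(G), #|'O_p(G)| %| p * p
    & {in 'O_p(G), forall x, f x \in P /\ {in P, forall n, a x n = n}}].
Proof.
have [G0 [nsG0 iG0 sG'G0 G0E]] := cocycle_preim_normal.
have [A [sAAut AE]] := Aut_actm aP (fun g Gg => sub_in2 (subsetP sPN) (aM Gg))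
  (fun g Gg => sub_in2 (subsetP sPN) (aI Gg))
  (fun g h Gg Gh => sub_in1 (subsetP sPN) (aJ Gg Gh)).
pose W := (G0 :&: 'ker A)%G.
have nsKG : 'ker A <| G := ker_normal A.
have nsWG : W <| G by apply: normalI.
have sWG := normal_sub nsWG.
have WE x : x \in W -> f x \in P /\ {in P, forall n, a x n = n}.
  case/setIP=> G0x Kx; have Gx := subsetP (normal_sub nsG0) x G0x.
  rewrite -G0E //; split=> // n Pn.
  by rewrite -AE // (mker Kx) perm1.
have abAut : abelian (Aut P) by apply: Aut_cyclic_abelian.
have sG'W : G^`(1) \subset W.
  rewrite subsetI sG'G0 der1_min ?ker_norm //.
  by rewrite (isog_abelian (first_isog A)) (abelianS sAAut).
have iK : #|G : 'ker A| %| p.-1.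
  rewrite -totient_prime // -oP -card_Aut_cyclic //.
  rewrite -[#|G : _|](_ : #|A @* G| = _) ?cardSg //.
  by rewrite card_morphim setIid.
have p'GW : p^'.-nat #|G : W|.
  rewrite -(Lagrange_index (normal_sub nsG0) (subsetIl _ _)) /= iG0 indexgI.
  have iG0K : #|G0 : 'ker A| %| #|G : 'ker A|.
    have nKG := normal_norm nsKG.
    have sG0G := normal_sub nsG0; have nKG0 := subset_trans sG0G nKG.
    by rewrite -!card_quotient // cardSg // quotientS.
  rewrite pnatM p'natE // gtnNdvd ?prime_gt0 //=.
  apply: pnat_dvd (dvdn_trans iG0K iK) _.
  have p1 := prime_gt1 pr_p.
  have [p10 p1p] : 0 < p.-1 /\ p.-1 < p by case: (p) p1 => [|[]].
  by rewrite p'natE // gtnNdvd.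
have [s Ns sN] := exQ.
pose z x := s^-1 * a x s.
have zP x : x \in G -> z x \in P by move=> Gx; apply: aNP.
have fWM : {in W &, {morph f : x y / x * y}}.
  move=> x y Wx Wy; have [Px _] := WE x Wx; have [_ ay1] := WE y Wy.
  by rewrite fM ?(subsetP sWG) // ay1.
have zM : {in W &, {morph z : x y / x * y}}.
  by apply: cocycle_shiftM => // x /WE[].
have mM : {in W &, {morph (fun x => (f x, z x)) : x y / x * y}}.
  by move=> x y Wx Wy /=; rewrite fWM // zM.
have PP x : x \in W -> (f x, z x) \in setX P P.
  by move=> Wx; rewrite inE /= (WE x Wx).1 zP // (subsetP sWG).
have ker1 : 'ker (Morphism mM) = 1.
  apply/trivgP/subsetP=> x /morphpreP[Wx]; rewrite inE -pair_eqE => /andP[].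
  move=> /= /eqP fx1 /eqP zx1; apply/set1P.
  have [_ ax1] := WE x Wx; have Gx := subsetP sWG x Wx.
  apply: (cocycle_faithful fa sHG kerf iHG core1 Gx fx1).
  apply: cocycle_act_triv Ns sN ax1 _ => //.
  by rewrite -[RHS]mulg1 -zx1 mulKVg.
have oW : #|W| %| p * p.
  by have := card_dvd_ker_codomain mM PP; rewrite ker1 cards1 mul1n cardsX oP.
have pW : p.-group W.
  by apply: pnat_dvd oW _; rewrite pnatM pnat_id.
have hallW : p.-Hall(G) W by rewrite /pHall sWG pW.
rewrite (normal_Hall_pcore hallW nsWG); split=> //.
Qed.

(** T is the kernel of the shift on 'O_p(G): the elements of 'O_p(G) acting
    on N as right translations.  The shift takes at most p values. *)
Lemma cocycle_pcore_triv : exists T : {group gT},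
  [/\ T <| G, T \subset 'O_p(G), #|'O_p(G)| %| p * #|T|
    & {in T, forall x, {in N, forall n, a x n = n}}].
Proof.
have [_ _ _ WE] := cocycle_pcore.
have sWG : 'O_p(G) \subset G := pcore_sub _ _.
have [s Ns sN] := exQ.
pose z x := s^-1 * a x s.
have zP x : x \in G -> z x \in P by move=> Gx; apply: aNP.
have zM : {in 'O_p(G) &, {morph z : x y / x * y}}.
  by apply: cocycle_shiftM => // x /WE[].
pose T := ('ker (Morphism zM))%G.
have T1 x : x \in T -> {in N, forall n, a x n = n}.
  move=> /morphpreP[Wx /set1P /= zx1].
  have [_ ax1] := WE x Wx; have Gx := subsetP sWG x Wx.
  apply: cocycle_act_triv Ns sN ax1 _ => //.
  by rewrite -[RHS]mulg1 -zx1 mulKVg.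
have sTW : T \subset 'O_p(G) := subsetIl _ _.
exists T; split=> //.
- rewrite /normal (subset_trans sTW) //; apply/normsP=> g Gg.
  apply/normP; rewrite inE; apply/subsetP=> _ /imsetP[x Tx ->].
  have Wx := subsetP sTW x Tx; have Gx := subsetP sWG x Wx.
  have [axg _] := cocycle_conj fa sHG kerf iHG Gx Gg (T1 x Tx).
  apply/morphpreP; split.
    by rewrite memJ_norm // (subsetP (gFnorm _ _)).
  by apply/set1P; rewrite /= /z axg // mulVg.
have PP x : x \in 'O_p(G) -> z x \in P by move=> /(subsetP sWG)/zP.
by have := card_dvd_ker_codomain zM PP; rewrite oP mulnC.
Qed.

End Cocycle.

End NonabelianNormalSylow.

(** * Nonabelian type: transport along an automorphism *)

Lemma sdprod_power (gT : finGroupType) (G T K : {group gT}) j :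
    T ><| K = G -> abelian T -> coprime #|T| j ->
  exists psi : {morphism G >-> gT},
    [/\ 'injm psi, psi @* G = G, {in T, forall t, psi t = t ^+ j}
      & {in K, forall k, psi k = k}].
Proof.
move=> defG abT co_j; have [_ mulTK nTK tiTK] := sdprodP defG.
have powM : {in T &, {morph (fun t => t ^+ j) : x y / x * y}}.
  by move=> x y Tx Ty /=; rewrite expgMn //; apply: (centsP abT).
pose fT := Morphism powM.
have actf : {in T & K, morph_act 'J 'J fT (idm K)}.
  by move=> t k Tt Kk; rewrite /= conjXg.
have injT : 'injm fT.
  apply/subsetP=> t /morphpreP[Tt /set1P /= tj]; apply/set1P.
  by apply/eqP; rewrite -order_eq1 -dvdn1 -(eqnP co_j) dvdn_gcd order_dvdG
    // order_dvdn tj eqxx.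
have imT : fT @* T = T.
  apply/eqP; rewrite eqEcard card_injm // leqnn andbT.
  by apply/subsetP=> _ /morphimP[t _ Tt ->]; apply: groupX.
exists (sdprodm_morphism defG actf); split.
- by rewrite injm_sdprodm injT injm_idm /= imT morphim_idm // tiTK.
- by rewrite im_sdprodm imT morphim_idm.
- by move=> t Tt; rewrite /= sdprodmEl.
by move=> k Kk; rewrite /= sdprodmEr.
Qed.

Section NonabelianType.

Variables (nT : finGroupType) (p q : nat) (N P Q : {group nT}).
Hypotheses (pr_p : prime p) (pr_q : prime q) (lt_qp : q < p).
Hypotheses (defN : P ><| Q = N) (oP : #|P| = p) (oQ : #|Q| = q).
Hypothesis notabN : ~~ abelian N.

Variables (gT : finGroupType) (G H : {group gT}).
Variables (f : gT -> nT) (a : gT -> nT -> nT).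
Hypothesis fa : cocycle G N f a.
Hypothesis sHG : H \subset G.
Hypothesis kerf : {in G, forall x, (f x == 1) = (x \in H)}.
Hypothesis iHG : #|G : H| = #|N|.
Hypothesis core1 : gcore H G = 1.

Let fN : {in G, forall x, f x \in N}. Proof. by case: fa. Qed.
Let aN : {in G, forall g, {in N, forall n, a g n \in N}}.
Proof. by case: fa. Qed.
Let aM : {in G, forall g, {in N &, {morph a g : m n / m * n}}}.
Proof. by case: fa. Qed.
Let fM : {in G &, forall x g, f (x * g) = a g (f x) * f g}.
Proof. by case: fa. Qed.
Let sPN : P \subset N. Proof. by case/sdprod_context: defN => /andP[]. Qed.
Let cycP : cyclic P. Proof. by rewrite prime_cyclic ?oP. Qed.
Let oN : #|N| = (p * q)%N. Proof. by rewrite -(sdprod_card defN) oP oQ. Qed.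
Let aP : {in G, forall g, {in P, forall x, a g x \in P}}.
Proof.
move=> g Gg x.
exact: (endo_Sylow pr_p pr_q lt_qp defN oP oQ (aN Gg) (aM Gg)).
Qed.

Let f' x := (f x)^-1.
Let a' g n := a g n ^ f g.
Let fa' : cocycle G N f' a'. Proof. exact: cocycle_flip fa. Qed.
Let kerf' : {in G, forall x, (f' x == 1) = (x \in H)}.
Proof. by move=> x Gx; rewrite /f' invg_eq1 kerf. Qed.

Let pcoreP := cocycle_pcore pr_p pr_q lt_qp defN oP oQ notabN fa sHG kerf iHG core1.

(** T1 acts on N by right translations and T2, which is T1 for the flipped
    cocycle, by left translations.  An element of both is a translation by a
    central element of N lying in P, so it is trivial; comparing orders gives
    the decomposition. *)
Lemma pcore_eigenlines : #|'O_p(G)| = (p * p)%N ->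
  exists T1 T2 : {group gT},
    [/\ [/\ T1 <| G, T2 <| G, #|T1| = p & #|T2| = p], T1 \x T2 = 'O_p(G),
        {in T1, forall x, {in N, forall n, a x n = n}}
      & {in T2, forall x, {in N, forall n, a x n ^ f x = n}}].
Proof.
move=> oW; have [_ _ _ WE] := pcoreP.
have [T1 [nsT1 sT1 dv1 T1E]] := cocycle_pcore_triv pr_p pr_q lt_qp defN oP oQ
  notabN fa sHG kerf iHG core1.
have [T2 [nsT2 sT2 dv2 T2E]] := cocycle_pcore_triv pr_p pr_q lt_qp defN oP oQ
  notabN fa' sHG kerf' iHG core1.
have [sT1G sT2G] := (normal_sub nsT1, normal_sub nsT2).
have ti12 : T1 :&: T2 = 1.
  apply/trivgP/subsetP=> x /setIP[T1x T2x]; apply/set1P.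
  have Gx := subsetP sT1G x T1x.
  suff fx1 : f x = 1.
    exact: (cocycle_faithful fa sHG kerf iHG core1 Gx fx1 (T1E x T1x)).
  have [Pfx _] := WE x (subsetP sT1 x T1x).
  apply/eqP/negPn/negP=> ntfx; case/negP: notabN.
  apply: abelianS (cyclic_abelian cycP); apply/subsetP=> n Nn.
  apply: (cent1_prime_factor pr_p pr_q defN oP oQ notabN Nn Pfx ntfx).
  by apply/commgP/conjg_fixP; have := T2E x T2x n Nn; rewrite /a' T1E.
have mul12 : #|T1 * T2| <= p * p.
  by rewrite -oW subset_leq_card // mul_subG.
have [p0 pp0] : 0 < p /\ 0 < p * p by rewrite muln_gt0 prime_gt0.
rewrite oW dvdn_pmul2l // in dv1; rewrite oW dvdn_pmul2l // in dv2.
have [le1 le2] := (dvdn_leq (cardG_gt0 T1) dv1, dvdn_leq (cardG_gt0 T2) dv2).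
rewrite TI_cardMg // in mul12.
have o1 : #|T1| = p.
  apply/eqP; rewrite eqn_leq le1 andbT -(leq_pmul2r p0).
  by apply: leq_trans mul12; rewrite leq_mul2l le2 orbT.
have o2 : #|T2| = p.
  apply/eqP; rewrite eqn_leq le2 andbT -(leq_pmul2l p0).
  by apply: leq_trans mul12; rewrite leq_mul2r le1 orbT.
exists T1, T2; split=> //.
have c12 : T2 \subset 'C(T1).
  apply/commG1P/trivgP; rewrite -ti12 setIC commg_subI //.
    by rewrite subsetI subxx (subset_trans sT2G) ?normal_norm.
  by rewrite subsetI subxx (subset_trans sT1G) ?normal_norm.
rewrite dprodE //; apply/eqP; rewrite eqEcard mul_subG //=.
by rewrite TI_cardMg // oW o1 o2.
Qed.

Section Transversal.

Variables T1 T2 : {group gT}.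
Hypotheses (nsT1 : T1 <| G) (nsT2 : T2 <| G) (oT1 : #|T1| = p) (oT2 : #|T2| = p).
Hypothesis defW : T1 \x T2 = 'O_p(G).
Hypothesis T1E : {in T1, forall x, {in N, forall n, a x n = n}}.
Hypothesis T2E : {in T2, forall x, {in N, forall n, a x n ^ f x = n}}.

(** An element h normalising the line spanned by t1 * t2 acts on T1 and on
    T2 by the same power map.  Identifying T1 and T2 with P through f, it acts on
    T2 as [a h], and on T1 as [a h] followed by conjugation by f h; hence f h
    centralises P. *)
Lemma transversal_scalar (X : {group gT}) t1 t2 : X \subset G ->
    t1 \in T1 -> t1 != 1 -> t2 \in T2 -> t2 != 1 ->
    X \subset 'N(<[t1 * t2]>) ->
  {in X, forall h, f h \in P}.
Proof.
move=> sXG Tt1 nt1 Tt2 nt2 nX h Xh; have Gh := subsetP sXG h Xh.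
have [_ mul12 c12 ti12] := dprodP defW.
have [_ _ _ WE] := pcoreP.
have [sT1W sT2W] : T1 \subset 'O_p(G) /\ T2 \subset 'O_p(G).
  by rewrite -mul12 mulG_subl mulG_subr.
have Gt1 := subsetP (normal_sub nsT1) t1 Tt1.
have Gt2 := subsetP (normal_sub nsT2) t2 Tt2.
have T1h : t1 ^ h \in T1 by rewrite memJ_norm // (subsetP (normal_norm nsT1)).
have T2h : t2 ^ h \in T2 by rewrite memJ_norm // (subsetP (normal_norm nsT2)).
have : (t1 * t2) ^ h \in <[t1 * t2]>.
  by rewrite memJ_norm ?cycle_id // (subsetP nX).
case/cycleP=> k; rewrite conjMg expgMn; last first.
  exact: commute_sym (centsP c12 _ Tt2 _ Tt1).
move=> E; have E1 : t1 ^ h = t1 ^+ k.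
  by rewrite -(divgrMid ti12 T1h T2h) E divgrMid ?groupX.
have E2 : t2 ^ h = t2 ^+ k.
  by rewrite -(remgrMid ti12 T1h T2h) E remgrMid ?groupX.
have f1M : {in T1 &, {morph f : x y / x * y}}.
  move=> x y T1x T1y; have sT1G := subsetP (normal_sub nsT1).
  by rewrite fM ?sT1G // T1E // fN ?sT1G.
have f2M : {in T2 &, {morph f' : x y / x * y}}.
  have [f'N _ _ f'M] := fa'.
  move=> x y T2x T2y; have sT2G := subsetP (normal_sub nsT2).
  by rewrite f'M ?sT2G // /a' T2E // f'N ?sT2G.
have [_ F1] := cocycle_conj fa sHG kerf iHG Gt1 Gh (T1E Tt1).
have [_ F2] := cocycle_conj fa' sHG kerf' iHG Gt2 Gh (T2E Tt2).
have [Pf1 _] := WE t1 (subsetP sT1W t1 Tt1).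
have [Pf2 _] := WE t2 (subsetP sT2W t2 Tt2).
have {Pf2} Pf2 : f' t2 \in P by rewrite groupV.
have nf1 : f t1 != 1.
  apply: contraNneq nt1 => f1; apply/eqP.
  exact: (cocycle_faithful fa sHG kerf iHG core1 Gt1 f1 (T1E Tt1)).
have nf2 : f' t2 != 1.
  apply: contraNneq nt2 => f1; apply/eqP.
  exact: (cocycle_faithful fa' sHG kerf' iHG core1 Gt2 f1 (T2E Tt2)).
rewrite E1 (morph_onX f1M Tt1) in F1.
rewrite E2 (morph_onX f2M Tt2) /a' /f' -conjgM mulgV conjg1 in F2.
have defP : P :=: <[f' t2]> by apply: generator_prime; rewrite ?oP.
(* read off on T2, where h acts as a h does on P *)
have ahk n : n \in P -> a h n = n ^+ k.
  rewrite defP => /cycleP[i ->]; rewrite (morph_onX (aM Gh)) ?(subsetP sPN) //.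
  by rewrite -F2 -!expgM mulnC.
have ahf1 := ahk _ Pf1.
apply: (cent1_prime_factor pr_p pr_q defN oP oQ notabN (fN Gh) (aP Gh Pf1)).
  rewrite -(morph_on1 (aM Gh)); apply: contraNneq nf1 => e; apply/eqP.
  apply: (cocycle_act_inj fa sHG kerf iHG Gh) e; rewrite ?group1 //.
  exact: fN.
by apply/commute_sym/commgP/conjg_fixP; rewrite -F1 ahf1.
Qed.

(** The line X meets 'O_p(G) in is generated by some t1 * t2, both factors
    being nontrivial as neither T1 nor T2 is that line.  By [transversal_scalar],
    X lies in G0, so a Hall p'-subgroup of X that is moved into D by conjugation
    lies in D :&: G0, and has the same order. *)
Lemma transversal_normal_form (G0 D X : {group gT}) :
    solvable G -> #|'O_p(G)| = (p * p)%N -> G0 <| G -> #|G : G0| = q ->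
    {in G, forall x, (x \in G0) = (f x \in P)} -> p^'.-Hall(G) D ->
    X \subset G -> #|G : X| = (p * q)%N -> ~~ ('O_p(G) :&: X <| G) ->
  exists w t1 t2, [/\ w \in G, t1 \in T1 /\ t1 != 1, t2 \in T2 /\ t2 != 1
    & X :^ w = <[t1 * t2]> * (D :&: G0)].
Proof.
move=> solG oW nsG0 iG0 G0E hallD sXG iX nnS.
have [sylW _ _ _] := pcoreP.
have nsWG : 'O_p(G) <| G := pcore_normal p G.
have [_ mul12 c12 ti12] := dprodP defW.
have [[sT1G nT1G] [sT2G nT2G]] := (andP nsT1, andP nsT2).
have co_pq : coprime p q by rewrite prime_coprime // dvdn_prime2 // gtn_eqF.
have p0 := prime_gt0 pr_p; have q0 := prime_gt0 pr_q.
pose S := ('O_p(G) :&: X)%G.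
have oS : #|S| = p.
  apply/eqP; rewrite -(eqn_pmul2r p0) -oW.
  by rewrite -{1}(index_normal_Sylow pr_p co_pq nsWG sylW sXG iX) LagrangeI.
have nsSX : S <| X by rewrite /= setIC; apply: normalGI nsWG.
have [y Sy nty] : exists2 y, y \in S & y != 1.
  by apply/trivgPn; rewrite trivg_card1 oS gtn_eqF ?prime_gt1.
have defS : S :=: <[y]> by apply: generator_prime; rewrite ?oS.
have /setIP[Wy Xy] := Sy.
have [t1 [t2 [Tt1 Tt2 defy]]] : exists t1 t2,
    [/\ t1 \in T1, t2 \in T2 & y = t1 * t2].
  by rewrite -mul12 in Wy; case/mulsgP: Wy => t1 t2 *; exists t1, t2.
have nt1 : t1 != 1.
  apply: contraNneq nnS => t11; rewrite -[_ :&: _]/(gval S) defS defy t11 mul1g.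
  rewrite -(generator_prime _ Tt2) ?oT2 //.
  by apply: contraNneq nty => t21; rewrite defy t11 t21 mulg1.
have nt2 : t2 != 1.
  apply: contraNneq nnS => t21; rewrite -[_ :&: _]/(gval S) defS defy t21 mulg1.
  rewrite -(generator_prime _ Tt1) ?oT1 //.
have sXG0 : X \subset G0.
  apply/subsetP=> h Xh; rewrite G0E ?(subsetP sXG) //.
  apply: (transversal_scalar sXG Tt1 nt1 Tt2 nt2) => //.
  by rewrite -defy -defS normal_norm.
have [C hallC] := Hall_exists p^' (solvableS sXG solG).
have [sCX p'C _] := and3P hallC.
have [w Gw sCwD] := Hall_Jsub solG hallD (subset_trans sCX sXG) p'C.
exists w, (t1 ^ w), (t2 ^ w); split=> //.
- by rewrite memJ_norm ?(subsetP nT1G) // conjg_eq1.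
- by rewrite memJ_norm ?(subsetP nT2G) // conjg_eq1.
have sylS := setI_normal_Hall nsWG sylW sXG.
have /sdprodP[_ <- _ _] := sdprod_normal_p'HallP nsSX hallC sylS.
rewrite defS conjsMg -cycleJ defy conjMg; congr (_ * _).
apply/eqP; rewrite eqEcard subsetI sCwD /=; apply/andP; split.
  have [_ nG0] := andP nsG0.
  by rewrite -(normsP nG0 w Gw) conjSg (subset_trans sCX).
rewrite cardJg (card_Hall hallC) (card_Hall (Hall_setI_normal nsG0 hallD)).
have : (#|X| * (p * q) = #|G0| * q)%N.
  by rewrite -iX -iG0 !Lagrange // normal_sub.
rewrite mulnA => /eqP; rewrite eqn_pmul2r // => /eqP <-.
have p''p : p^'^'.-nat p by rewrite pnatNK pnat_id.
by rewrite partnM ?cardG_gt0 // (part_p'nat p''p) muln1.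
Qed.

End Transversal.

(** If 'O_p(G) meets H' in a normal subgroup of G, the factorisation of
    [cocycle_type_of_Sylow] applies.  Otherwise 'O_p(G) has order p ^ 2, and H,
    which has trivial core, is in the same position as H'.  Both then have the
    form of [transversal_normal_form], and differ, up to conjugacy, only by the
    line they contain; an automorphism of G moves one line to the other. *)
Lemma cocycle_type_nonabelian (H' : {group gT}) :
  H' \subset G -> #|G : H'| = (p * q)%N -> cocycle_type G H' N.
Proof.
move=> sHG' iH'; have [sylW sG'W dvW _] := pcoreP.
have neq_pq : p != q by rewrite gtn_eqF.
have co_pq : coprime p q by rewrite prime_coprime // dvdn_prime2.
have p0 := prime_gt0 pr_p; have q0 := prime_gt0 pr_q.
have nsWG : 'O_p(G) <| G := pcore_normal p G.
have solG : solvable G.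
  by rewrite (series_sol nsWG) (pgroup_sol (pcore_pgroup p G))
    abelian_sol ?sub_der1_abelian.
have [nsS | nnS] := boolP ('O_p(G) :&: H' <| G).
  exact: cocycle_type_of_Sylow nsWG sylW sHG' iH' nsS defN oP oQ (or_intror _).
have oW : #|'O_p(G)| = (p * p)%N.
  have iS := index_normal_Sylow pr_p co_pq nsWG sylW sHG' iH'.
  rewrite -(LagrangeI _ H') iS in dvW *; rewrite dvdn_pmul2r // in dvW.
  congr (_ * _)%N; case/primeP: (pr_p) => _ dvp.
  case/pred2P: (dvp _ dvW) => // /eqP; rewrite -trivg_card1 => /eqP S1.
  by rewrite S1 normal1 in nnS.
have iH : #|G : H| = (p * q)%N by rewrite iHG oN.
have nnS0 : ~~ ('O_p(G) :&: H <| G).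
  have iS := index_normal_Sylow pr_p co_pq nsWG sylW sHG iH.
  apply/negP=> nsS.
  have S1 : 'O_p(G) :&: H = 1.
    by apply/trivgP; rewrite -core1 sub_gcore ?subsetIr // normal_norm.
  have := LagrangeI 'O_p(G) H; rewrite S1 cards1 mul1n iS oW => /eqP.
  by rewrite -{1}[p]mul1n eqn_pmul2r // ltn_eqF ?prime_gt1.
have [G0 [nsG0 iG0 _ G0E]] := cocycle_preim_normal pr_p pr_q lt_qp defN oP oQ
  notabN fa sHG kerf iHG.
have [D hallD] := Hall_exists p^' solG.
have [T1 [T2 [[nsT1 nsT2 oT1 oT2] defW T1E T2E]]] := pcore_eigenlines oW.
have [w0 [a1 [a2 [Gw0 [Ta1 na1] [Ta2 na2] defH]]]] :=
  transversal_normal_form nsT1 nsT2 oT1 oT2 defW T1E T2E solG oW nsG0 iG0 G0E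
    hallD sHG iH nnS0.
have [w [b1 [b2 [Gw [Tb1 nb1] [Tb2 nb2] defH']]]] :=
  transversal_normal_form nsT1 nsT2 oT1 oT2 defW T1E T2E solG oW nsG0 iG0 G0E
    hallD sHG' iH' nnS.
have [_ mul12 c12 ti12] := dprodP defW.
have [i a1E] : exists i, a1 = b1 ^+ i.
  by apply/cycleP; rewrite -(generator_prime _ Tb1) ?oT1.
pose u := b2 ^+ i; have Tu : u \in T2 by apply: groupX.
have ntu : u != 1.
  have ob1 : #[b1] = p by rewrite /order -(generator_prime _ Tb1) ?oT1.
  have ob2 : #[b2] = p by rewrite /order -(generator_prime _ Tb2) ?oT2.
  by apply: contraNneq na1 => /eqP; rewrite -order_dvdn ob2 a1E -order_dvdn ob1.
(* a power of the generator b1 * b2 has the component a1 of the line of H, so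
   that only the component in T2 remains to be adjusted *)
have genE : <[b1 * b2]> = <[a1 * u]>.
  have cb : commute b1 b2 := commute_sym (centsP c12 _ Tb2 _ Tb1).
  have nt1 x y : x \in T1 -> y \in T2 -> y != 1 -> x * y != 1.
    move=> T1x T2y; apply: contraNneq => xy1; apply/eqP/set1P.
    rewrite -[[set 1]]ti12 inE T2y.
    rewrite andbT -groupV; move/eqP: xy1; rewrite -eq_invg_mul => /eqP<-.
    by rewrite invgK.
  have -> : a1 * u = (b1 * b2) ^+ i by rewrite expgMn // a1E.
  apply: generator_prime; last 2 first.
  - exact: mem_cycle.
  - by rewrite expgMn // -a1E nt1.
  suff ob : #[b1 * b2] = p by rewrite -[#|_|]/(#[_]) ob.
  have [b1p b2p] : b1 ^+ p = 1 /\ b2 ^+ p = 1.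
    by rewrite -{1}oT1 -oT2 !expg_cardG.
  apply/(prime_nt_dvdP pr_p); first by rewrite order_eq1 nt1.
  by rewrite order_dvdn expgMn // b1p b2p mulg1.
have [j a2E] : exists j, a2 = u ^+ j.
  by apply/cycleP; rewrite -(generator_prime _ Tu) ?oT2.
have co_j : coprime #|T2| j.
  rewrite oT2 prime_coprime //; apply: contraNN na2 => dvj.
  by rewrite a2E -order_dvdn (dvdn_trans _ dvj) // -oT2 order_dvdG.
have defG := sdprod_normal_p'HallP nsWG hallD sylW.
have [_ mulWD nWD tiWD] := sdprodP defG.
have [sDG _ _] := and3P hallD.
have nT1D : D \subset 'N(T1) := subset_trans sDG (normal_norm nsT1).
pose K := (T1 <*> D)%G.
have sKG : K \subset G by rewrite join_subG normal_sub.
have defG2 : T2 ><| K = G.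
  have mulG2 : T2 * K = G.
    by rewrite /= norm_joinEr // mulgA (centC c12) mul12.
  rewrite sdprodE //; first exact: subset_trans sKG (normal_norm nsT2).
  apply: cardMg_TI; rewrite mulG2 -(sdprod_card defG) oW oT2 -mulnA leq_mul2l.
  rewrite /= norm_joinEr // -oT1 -TI_cardMg ?leqnn ?orbT //.
  by apply/trivgP; rewrite -tiWD setSI // -mul12 mulG_subl.
have abT2 : abelian T2 by rewrite cyclic_abelian // prime_cyclic ?oT2.
(* psi adjusts T2 and fixes T1 and D, so it maps the normal form of H' to that
   of H *)
have [psi [injpsi impsi psiT2 psiK]] := sdprod_power defG2 abT2 co_j.
have [sT1K sDK] : T1 \subset K /\ D \subset K.
  by rewrite joing_subl joing_subr.
have Ga1 := subsetP (normal_sub nsT1) _ Ta1.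
have Gu := subsetP (normal_sub nsT2) _ Tu.
have imH : psi @* (H' :^ w) = H :^ w0.
  rewrite defH' defH genE morphimMl ?cycle_subG ?groupM //.
  rewrite morphim_cycle ?groupM // morphM //.
  rewrite (psiK _ (subsetP sT1K _ Ta1)) psiT2 // -a2E; congr (_ * _).
  rewrite morphimEsub; last by rewrite subIset // sDG.
  rewrite -[RHS]imset_id; apply: eq_in_imset => x /setIP[Dx _].
  by rewrite psiK // (subsetP sDK).
have sHwG : H' :^ w \subset G by rewrite -(conjGid Gw) conjSg.
apply: (cocycle_type_conj Gw sHG').
apply: (cocycle_type_pullback (r := psi) (G2 := G) (H2 := (H :^ w0)%G)) => //.
- by rewrite impsi.
- move=> x Gx; rewrite /= -imH.
  apply/idP/idP=> [/morphimP[y Gy Hy e] | Hx]; last exact: mem_morphim.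
  by rewrite (injmP injpsi _ _ Gx Gy e).
- by rewrite /= -{1}(conjGid Gw) indexJg iH' oN.
apply: (@cocycle_type_conj _ _ _ _ _ (w0^-1)); rewrite ?groupV //.
  by rewrite /= -(conjGid Gw0) conjSg.
suff -> : ((H :^ w0) :^ w0^-1)%G = H by exists f, a.
by apply: val_inj; rewrite /= conjsgK.
Qed.

End NonabelianType.

(** * Orders pq *)

Lemma sdprod_order_pq (gT : finGroupType) (p q : nat) (N : {group gT}) :
    prime p -> prime q -> q < p -> #|N| = (p * q)%N ->
  exists P Q : {group gT}, [/\ P ><| Q = N, #|P| = p & #|Q| = q].
Proof.
move=> pr_p pr_q lt_qp oN.
have co_pq : coprime p q by rewrite prime_coprime // dvdn_prime2 // gtn_eqF.
have partpq a b : prime a -> coprime a b -> 0 < b -> ((a * b)`_a = a)%N.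
  move=> pr_a co_ab b0; have a'b : a^'.-nat b by rewrite p'natE // -prime_coprime.
  rewrite partnM ?(prime_gt0 pr_a) // (part_p'nat a'b) muln1.
  exact: part_pnat_id (pnat_id pr_a).
have [P sylP] := Sylow_exists p N; have [Q sylQ] := Sylow_exists q N.
have oP : #|P| = p by rewrite (card_Hall sylP) oN partpq ?prime_gt0.
have oQ : #|Q| = q.
  by rewrite (card_Hall sylQ) oN mulnC partpq ?prime_gt0 1?coprime_sym.
have [sPN sQN] := (pHall_sub sylP, pHall_sub sylQ).
have nPN : N \subset 'N(P).
  have iP : #|N : P| = q by rewrite -divgS // oN oP mulKn ?prime_gt0.
  have := card_Syl_mod N pr_p; rewrite (card_Syl sylP) => n1.
  have dv : #|N : 'N_N(P)| %| q by rewrite -iP indexgS // subsetI sPN normG.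
  have le := dvdn_leq (prime_gt0 pr_q) dv.
  have : #|N : 'N_N(P)| == 1%N by rewrite -n1 modn_small // (leq_ltn_trans le).
  by rewrite indexg_eq1 subsetI subxx.
exists P, Q; split=> //.
have tiPQ : P :&: Q = 1 by rewrite coprime_TIg // oP oQ.
rewrite sdprodE ?(subset_trans sQN) //; apply/eqP.
by rewrite eqEcard mul_subG //= TI_cardMg // oN oP oQ.
Qed.

Theorem cocycle_type_parallel (gT nT : finGroupType) (p q : nat)
    (G H H' : {group gT}) (N : {group nT}) :
    prime p -> prime q -> q < p -> #|N| = (p * q)%N ->
    cocycle_type G H N -> gcore H G = 1 ->
    H' \subset G -> #|G : H'| = (p * q)%N ->
  cocycle_type G H' N.
Proof.
move=> pr_p pr_q lt_qp oN tH core1 sHG' iH'.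
have [P [Q [defN oP oQ]]] := sdprod_order_pq pr_p pr_q lt_qp oN.
have [abN | nabN] := boolP (abelian N).
  exact: cocycle_type_abelian defN oP oQ abN tH core1 sHG' iH'.
have [f [a [fa sHG kerf iHG]]] := tH.
exact: (cocycle_type_nonabelian pr_p pr_q lt_qp defN oP oQ nabN fa sHG kerf
  iHG core1 sHG' iH').
Qed.

(** * Regular subgroups and cocycles *)

Lemma coset_translationE (gT : finGroupType) (G G' : {group gT}) g (C : {set gT}) :
  g \in G -> C \in rcosets G' G -> coset_translation G G' g C = C :* g.
Proof.
move=> Gg XC; rewrite /coset_translation restr_permE //; last first.
  rewrite inE; apply/andP; split; first by rewrite inE.
  rewrite inE; apply/subsetP=> _ /rcosetsP[x Gx ->]; rewrite inE /= /aperm.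
  by rewrite actpermE /= rcosetE -rcosetM; apply/rcosetsP; exists (x * g);
    rewrite ?groupM.
by rewrite actpermE /= rcosetE.
Qed.

Lemma rcosets_translation (gT : finGroupType) (G G' : {group gT}) g (C : {set gT}) :
  g \in G -> C \in rcosets G' G -> C :* g \in rcosets G' G.
Proof.
move=> Gg /rcosetsP[x Gx ->]; rewrite -rcosetM.
by apply/rcosetsP; exists (x * g); rewrite ?groupM.
Qed.

(** f x is the element of R that sends the base coset G' to G' :* x.
    Translation by g followed by the inverse of f g fixes the base coset and
    normalises R, so conjugation by it is the automorphism part. *)
Lemma cocycle_type_of_regular (gT nT : finGroupType) (G G' : {group gT})
    (N : {group nT}) (R : {group {perm {set gT}}}) :
    G' \subset G -> regular_on (rcosets G' G) R ->
    [set coset_translation G G' g | g in G] \subset 'N(R) -> R \isog N ->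
  cocycle_type G G' N.
Proof.
move=> sG'G [sRX transR regR] nRG isoRN; apply: (cocycle_type_isog isoRN).
pose X := rcosets G' G; pose lam := coset_translation G G'.
have XG' : (G' : {set gT}) \in X.
  by apply/rcosetsP; exists 1; rewrite ?mulg1.
pose f x : {perm {set gT}} := odflt 1 [pick r in R | r (G' : {set gT}) == G' :* x].
have fP x : x \in G -> f x \in R /\ f x G' = G' :* x.
  move=> Gx; rewrite /f; case: pickP => [r /andP[Rr /eqP rG'] // | no] /=.
  have Xx : G' :* x \in X by apply/rcosetsP; exists x.
  have [r Rr e] := atransP2 transR XG' Xx.
  by have := no r; rewrite Rr -[r _]/(aperm _ r) -e eqxx.
have Rinj r s : r \in R -> s \in R -> r (G' : {set gT}) = s G' -> r = s.
  move=> Rr Rs e; apply/eqP; rewrite eq_mulgV1; apply/eqP/set1P.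
  rewrite -[[set 1]](regR _ XG') inE groupM ?groupV //=.
  by apply/astab1P; rewrite /= /aperm permM e permK.
have lamE g C : g \in G -> C \in X -> lam g C = C :* g.
  exact: coset_translationE.
have lamN g : g \in G -> lam g \in 'N(R).
  by move=> Gg; apply: (subsetP nRG); apply: imset_f.
(* products of permutations are read from left to right *)
pose c g := lam g * (f g)^-1.
have cN g : g \in G -> c g \in 'N(R).
  move=> Gg; rewrite groupM ?lamN // groupV.
  by rewrite (subsetP (normG R)) //; case: (fP g Gg).
exists f, (fun g r => r ^ c g); split=> //.
- split=> [x /fP[] // | g Gg r Rr | g Gg r s _ _ | x g Gx Gg].
  + by rewrite memJ_norm ?cN.
  + exact: conjMg.
  have [[Rx fx] [Rg fg]] := (fP x Gx, fP g Gg).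
  have [Rxg fxg] := fP _ (groupM Gx Gg).
  apply: Rinj => //; first by rewrite groupM // memJ_norm ?cN.
  have -> : f x ^ c g * f g = f g * f x ^ lam g.
    by rewrite /c conjgM [_ ^ (f g)^-1]conjgE invgK -!mulgA mulVg mulg1.
  rewrite permM fg fxg conjgE !permM.
  have -> : (lam g)^-1 (G' :* g) = G'.
    by rewrite -(lamE g G') ?permK.
  by rewrite fx lamE // ?rcosetM //; apply/rcosetsP; exists x.
- move=> x Gx; have [Rx fx] := fP x Gx.
  apply/eqP/idP => [f1 | G'x].
    by have := rcoset_refl G' x; rewrite -fx f1 perm1.
  by apply: Rinj => //; rewrite fx perm1 rcoset_id.
rewrite -[LHS]/#|rcosets G' G| -(atransP transR _ XG') card_orbit.
by rewrite regR // indexg1.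
Qed.

(** The value of f at a coset identifies the coset space with N, and G then
    acts through Hol(N), which normalises the right translations of N; R is the
    group of these translations. *)
Lemma regular_of_cocycle_type (gT nT : finGroupType) (G G' : {group gT})
    (N : {group nT}) :
    cocycle_type G G' N ->
  exists R : {group {perm {set gT}}},
    [/\ regular_on (rcosets G' G) R,
        [set coset_translation G G' g | g in G] \subset 'N(R) & R \isog N].
Proof.
case=> f [a [fa sG'G kerf iG']]; have [fN aN aM fM] := fa.
pose X := rcosets G' G; pose lam := coset_translation G G'.
pose b (C : {set gT}) := f (repr C).
have Gx1 x C : x \in G -> C = G' :* x -> C \in X.
  by move=> Gx ->; apply/rcosetsP; exists x.
have bE x : x \in G -> b (G' :* x) = f x.
  move=> Gx; have /rcosetP[h G'h e] := mem_repr_rcoset G' x.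
  have Gh := subsetP sG'G h G'h.
  by rewrite /b e; apply/eqP; rewrite (cocycle_eq fa kerf) ?mulgK ?groupM.
have bN C : C \in X -> b C \in N.
  by case/rcosetsP=> x Gx ->; rewrite bE ?fN.
have bI : {in X &, injective b}.
  move=> _ _ /rcosetsP[x Gx ->] /rcosetsP[y Gy ->]; rewrite !bE // => /eqP.
  by rewrite (cocycle_eq fa kerf) // -mem_rcoset => /rcoset_eqP.
pose c n := odflt (G' : {set gT}) [pick C in X | b C == n].
have cP n : n \in N -> c n \in X /\ b (c n) = n.
  move=> Nn; rewrite /c; case: pickP => [C /andP[XC /eqP bC] // | no].
  have [x Gx fx] := cocycle_onto fa sG'G kerf iG' Nn.
  by have := no (G' :* x); rewrite (Gx1 x) // bE // fx eqxx.
pose pf m C := if (m \in N) && (C \in X) then c (b C * m) else C.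
have pfX m C : m \in N -> C \in X -> pf m C \in X /\ b (pf m C) = b C * m.
  by move=> Nm XC; rewrite /pf Nm XC; apply: cP; rewrite groupM ?bN.
have pf_inj m : injective (pf m).
  have [Nm | N'm] := boolP (m \in N); last first.
    by move=> C D; rewrite /pf (negPf N'm).
  have pfO C : C \notin X -> pf m C = C by rewrite /pf Nm => /negPf->.
  move=> C D; have [XC | X'C] := boolP (C \in X);
    have [XD | X'D] := boolP (D \in X); move=> e.
  - have [[_ eC] [_ eD]] := (pfX m C Nm XC, pfX m D Nm XD).
    by apply: bI => //; apply: (mulIg m); rewrite -eC -eD e.
  - by have [XpC _] := pfX m C Nm XC; rewrite e pfO // (negPf X'D) in XpC.
  - by have [XpD _] := pfX m D Nm XD; rewrite -e pfO // (negPf X'C) in XpD.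
  by rewrite !pfO in e.
pose pi m : {perm {set gT}} := perm (pf_inj m).
have piX m C : m \in N -> C \in X -> pi m C \in X /\ b (pi m C) = b C * m.
  by rewrite permE; apply: pfX.
have piO m C : C \notin X -> pi m C = C.
  by move=> X'C; rewrite permE /pf (negPf X'C) andbF.
have piM : {in N &, {morph pi : m n / m * n}}.
  move=> m n Nm Nn; apply/permP=> C; rewrite permM.
  have [XC | X'C] := boolP (C \in X); last by rewrite !piO.
  have [Xm bm] := piX m C Nm XC; have [Xn bn] := piX n _ Nn Xm.
  have [Xmn bmn] := piX _ C (groupM Nm Nn) XC.
  by apply: bI => //; rewrite bmn bn bm mulgA.
have piE m C : m \in N -> C \in X -> pi m C = C -> m = 1.
  move=> Nm XC piC; have [_] := piX m C Nm XC; rewrite piC => e.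
  by apply: (mulgI (b C)); rewrite mulg1 -e.
have XG' : (G' : {set gT}) \in X by apply: (Gx1 1); rewrite ?mulg1.
have injpi : 'injm (Morphism piM).
  apply/subsetP=> m /morphpreP[Nm /set1P /= pi1]; apply/set1P.
  by apply: (piE m G') => //; rewrite pi1 perm1.
pose R := (Morphism piM @* N)%G.
have RP r : r \in R -> exists2 m, m \in N & r = pi m.
  by case/morphimP=> m _ Nm ->; exists m.
have Rpi m : m \in N -> pi m \in R.
  by move=> Nm; apply: (mem_morphim (Morphism piM)).
exists R; split; last first.
- by rewrite isog_sym; apply/isogP; exists (Morphism piM).
- apply/subsetP=> _ /imsetP[g Gg ->]; rewrite -/(lam g).
  rewrite inE; apply/subsetP=> _ /imsetP[_ /RP[m Nm ->] ->].
  pose m' := a g m ^ f g.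
  have Nm' : m' \in N by rewrite groupJ ?aN ?fN.
  suff -> : pi m ^ lam g = pi m' by apply: Rpi.
  apply: (mulgI (lam g)); rewrite -conjgC; apply/permP=> C; rewrite !permM.
  have [XC | X'C] := boolP (C \in X); last first.
    have lamO : lam g C = C.
      exact: out_perm (restr_perm_on _ _) X'C.
    by rewrite piO // lamO piO.
  have lamE D : D \in X -> [/\ lam g D = D :* g, lam g D \in X
      & b (lam g D) = a g (b D) * f g].
    move=> XD; rewrite /lam coset_translationE //.
    split=> //; first exact: rcosets_translation.
    have /rcosetsP[x Gx ->] := XD.
    by rewrite -rcosetM !bE ?groupM // fM.
  have [XpC bpC] := piX m C Nm XC.
  have [_ XlC blC] := lamE C XC; have [_ XlpC blpC] := lamE _ XpC.
  have [XplC bplC] := piX m' _ Nm' XlC.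
  apply: bI => //; rewrite bplC blC blpC bpC aM ?bN //.
  by rewrite /m' -!mulgA -conjgC.
split.
- apply/subsetP=> _ /RP[m Nm ->]; rewrite inE; apply/subsetP=> C.
  by rewrite inE; apply: contraR => /piO->.
- apply/imsetP; exists (G' : {set gT}) => //; apply/setP=> C.
  apply/idP/orbitP=> [XC | [_ /RP[m Nm ->] <-]]; last by case: (piX m G' Nm XG').
  have Nm : (b G')^-1 * b C \in N by rewrite groupM ?groupV ?bN.
  exists (pi ((b G')^-1 * b C)); first exact: Rpi.
  have [XpC bpC] := piX _ G' Nm XG'.
  by apply: bI => //; rewrite /= /aperm bpC mulKVg.
move=> C XC; apply/trivgP/subsetP=> r /setIP[/RP[m Nm ->] /astab1P piC].
apply/set1P; rewrite (piE m C Nm XC piC).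
exact: (morph1 (Morphism piM)).
Qed.

(** * Galois groups *)

Section GaloisSide.
Variables (K : fieldType) (E : splittingFieldType K).

Lemma galois_closure_full (L E0 : {subfield E}) :
  is_galois_closure L {:E}%AS -> is_galois_closure L E0 -> E0 = {:E}%AS.
Proof.
case=> _ _ minE [galE0 sLE0 _]; apply: val_inj => /=.
by apply/eqP; rewrite eqEsubv subvf minE.
Qed.

Variable galE : galois 1%AS {:E}%AS.

(** The fixed field of the core contains L and is Galois over K, so it is E. *)
Lemma gcore_Gal_eq1 (L : {subfield E}) : is_galois_closure L {:E}%AS ->
  gcore 'Gal({:E}%AS / L) 'Gal({:E}%AS / 1%AS) = 1.
Proof.
case=> _ _ minE; set C := gcore _ _.
have nsCG : C <| 'Gal({:E}%AS / 1%AS).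
  by apply: gcore_normal; rewrite galS ?sub1v.
have galF := normal_fixedField_galois galE nsCG.
have sL : (L <= fixedField C)%VS.
  by rewrite -galois_connection ?subvf // gcore_sub.
have sEF := minE [aspace of fixedField C] galF sL.
apply/trivgP/subsetP=> x Cx; apply/set1P/eqP/gal_eqP=> u Eu.
rewrite gal_id; have /mem_fixedFieldP[_] := subvP sEF u Eu.
exact.
Qed.

Lemma index_Gal (L : {subfield E}) :
  #|'Gal({:E}%AS / 1%AS) : 'Gal({:E}%AS / L)| = \dim L.
Proof.
have galLE : galois L {:E}%AS by apply: galoisS galE; rewrite sub1v subvf.
rewrite -(dim_fixed_galois galE); last by rewrite galS ?sub1v.
by rewrite (galois_fixedField galLE) dimv1 divn1.
Qed.

(** The Galois closure of L is the fixed field of the core of Gal(E / L),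
    which is also the kernel of the restriction to that field. *)
Lemma cocycle_type_galois_closure (nT : finGroupType) (N : {group nT})
    (L : {subfield E}) :
    cocycle_type 'Gal({:E} / 1%AS)%G 'Gal({:E} / L)%G N ->
  exists2 F : {subfield E}, is_galois_closure L F
    & cocycle_type 'Gal(F / 1%AS)%G 'Gal(F / L)%G N.
Proof.
set G := ('Gal(_ / 1%AS))%G; set H := ('Gal(_ / L))%G => tH.
have sHG : H \subset G by rewrite galS ?sub1v.
have nsCG : gcore H G <| G := gcore_normal sHG.
pose F := [aspace of fixedField (gcore H G)].
have galF : galois 1%AS F := normal_fixedField_galois galE nsCG.
have sLF : (L <= F)%VS by rewrite -galois_connection ?subvf // gcore_sub.
have closF : is_galois_closure L F.
  split=> // M galM sLM.
  have galME : galois M {:E} by apply: galoisS galE; rewrite sub1v subvf.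
  have [_ _ nM] := and3P galM.
  rewrite -(galois_fixedField galME) fixedFieldS // sub_gcore ?galS //.
  by rewrite normal_norm // (normalField_normal _ nM) ?sub1v ?subvf.
exists F => //.
have [_ _ n1F] := and3P galF.
have s1FE : (1%AS <= F <= {:E}%AS)%VS by rewrite sub1v subvf.
have sLFE : (L <= F <= {:E}%AS)%VS by rewrite sLF subvf.
have galLE : galois L {:E}%AS by apply: galoisS galE; rewrite sub1v subvf.
have nLF : normalField L F := normalFieldS (sub1v _) n1F.
apply: (cocycle_type_pushforward (r := normalField_cast_morphism s1FE n1F)) tH.
- exact: normalField_img.
- apply: etrans (normalField_img galLE sLFE nLF).
  by rewrite morphimEdom morphimEsub.
by rewrite normalField_ker gal_fixedField gcore_sub.
Qed.

End GaloisSide.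

Theorem theorem3p9 (p q : nat) (p_prime : prime p) (q_prime : prime q)
    (p_odd : odd p) (q_odd : odd q) (q_lt_p : q < p) (p_mod_q : p = 1 %[mod q])
    (gT : finGroupType) (N : {group gT}) (N_order : #|N| = (p * q)%N)
    (K : fieldType) (E : splittingFieldType K) (L : {subfield E})
    (L_separable : separable 1%AS L) (L_degree : \dim L = (p * q)%N)
    (E_closure : is_galois_closure L {:E}%AS)
    (L_HGS : admits_Hopf_Galois_structure L N) :
  forall L' : {subfield E},
    parallel_extension L L' -> admits_Hopf_Galois_structure L' N.
Proof.
move=> L' dimL'; have galE : galois 1%AS {:E}%AS by case: E_closure.
have [E0 closE0 [R [regR nRG isoR]]] := L_HGS.
have defE0 := galois_closure_full E_closure closE0.
rewrite {}defE0 {closE0} in R regR nRG isoR.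
have typeL := cocycle_type_of_regular (galS _ (sub1v L)) regR nRG isoR.
have typeL' : cocycle_type 'Gal({:E} / 1%AS)%G 'Gal({:E} / L')%G N.
  apply: (cocycle_type_parallel p_prime q_prime q_lt_p N_order typeL).
  - exact: gcore_Gal_eq1.
  - by rewrite galS ?sub1v.
  by rewrite index_Gal // -L_degree.
have [F closF typeF] := cocycle_type_galois_closure galE typeL'.
by exists F => //; apply: regular_of_cocycle_type.
Qed.
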